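(* Let $(K,R)\in\mathcal K\times\mathcal R$ satisfy (R1), (R2), (R3) and the robust no-arbitrage property $NA^r(K,R)$. Then, for all $x\in\mathbb R^d\times\mathbb R_+^N$, the sets $A_T(x;K,R)$ and $\mathcal C_T(x;K,R)$ are closed in probability.
   Context: Fix integers $T,d,N\ge1$, $\mathbb T=\{0,\dots,T\}$, and a probability space $(\Omega,\mathcal F,\mathbb P)$ with filtration $\mathbb F=(\mathcal F_t)_{t\in\mathbb T}$, $\mathcal F_T=\mathcal F$, $\mathcal F_0$ trivial. Vectors $x\in\mathbb R^{d+N}$ are written $x=(x^F,x^I)$ with $x^F\in\mathbb R^d$, $x^I\in\mathbb R^N$; $0_p$ is the zero of $\mathbb R^p$. For a (possibly random) set $E$, $L^0(E;\mathcal F_t)$ is the set of $\mathcal F_t$-measurable random variables with values in $E$ a.s. ($\mathcal F_T$ when omitted), and $L^0(E;\mathbb F)$ the set of $\mathbb F$-adapted processes indexed by $\mathbb T$ with values in $E$ (convergence in probability of processes means convergence in probability at each $t\in\mathbb T$); $\mathrm{ri}$ denotes relative interior. $\mathcal K$: the set of $K=(K_t)_{t\in\mathbb T}$ for which there is a countable sequence of $\mathbb R^{d+N}$-valued processes $X^n=(X^n_t)_{t\in\mathbb T}$ such that for every $t\in\mathbb T$, a.s. only a finite but nonzero number of the $X^n_t$ are different from zero, $K_t$ is the (polyhedral) convex cone generated by $\{X_t^n,n\in\mathbb N\}$, and $\mathbb R_+^{d+N}\setminus\{0\}\subset\mathrm{int}(K_t)$ a.s. Write $\underline K_t=K_t\cap(\mathbb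 R^d\times\{0_N\})$ and $\underline K^0_t=\underline K_t\cap(-\underline K_t)$, and similarly for $\tilde K$. $\mathcal R$: the set of adapted processes $R=(R_t)_{t\in\mathbb T}$ with values in the set of mappings from $\mathbb R_+^N$ into $\mathbb R^d\times\{0_N\}$, i.e. $R_t(x)$ is $\mathcal F_t$-measurable for all $x\in\mathbb R_+^N$. Strategies and claims: for $\xi\in L^0(\mathbb R^{d+N};\mathbb F)$, $I(\xi)_t:=\big(\sum_{s=0}^t\xi_s^{d+i}\big)_{1\le i\le N}$. For $x\in\mathbb R^d\times\mathbb R_+^N$, $\mathcal A(x;K)$ is the set of $\xi\in L^0(\mathbb R^{d+N};\mathbb F)$ with $\xi_t\in-K_t$ and $I(\xi)_t+x^I\in\mathbb R_+^N$ a.s. for all $t\in\mathbb T$, and $$A_T(x;K,R)=\Big\{x+\sum_{t=0}^T\xi_t+\sum_{t=0}^{T-1}R_{t+1}(x^I+I(\xi)_t):\ \xi\in\mathcal A(x;K)\Big\},\qquad A_T(K,R):=A_T(0;K,R).$$ Consumption: $\mathcal C_T(x;K,R)=\{c\in L^0(\mathbb R_+^d;\mathbb F):(\sum_{t\in\mathbb T}c_t,0_N)\in A_T(x;K,R)\}$. Conditions on $(K,R)$, a.s. for each $t\in\mathbb T$: (R1) $R_t(0)=0$ and $R_t$ is continuous. (R2) For $\lambda\in[0,1]$ and $\alpha,\beta\in L^0(\mathbb R_+^N)$, $\lambda R_t(\alpha)+(1-\lambda)R_t(\beta)-R_t(\lambda\alpha+(1-\lambda)\beta)\in-\underline K_t$.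 (R3) There are $a_t\in L^0(\mathbb R^{d+N})$ and $L\in\mathcal R$ such that $\lambda L_t(\alpha)=L_t(\lambda\alpha)$ a.s. and $R_t(\alpha)+a_t+L_t(\alpha)\in L^0(\mathbb R_+^{d+N})$ for all $(\lambda,\alpha)\in L^0(\mathbb R_+\times\mathbb R_+^N)$. No-arbitrage: $NA(K,R)$ means $A_T(K,R)\cap L^0(\mathbb R_+^{d+N})=\{0\}$. $(\tilde K,\tilde R)\in\mathcal K\times\mathcal R$ dominates $(K,R)$ if, for each $t\in\mathbb T$: (D1) $\underline K_t\setminus\underline K_t^0\subset\mathrm{ri}(\underline{\tilde K}_t)$ and $K_t\subset\tilde K_t$; (D2) $\tilde R_t(0)\in\underline K_t$ and $\tilde R_t(\alpha)-R_t(\alpha)\in\mathrm{ri}(\underline K_t)$ for all $\alpha\in\mathbb R_+^N\setminus\{0\}$. $NA^r(K,R)$ means that $NA(\tilde K,\tilde R)$ holds for some $(\tilde K,\tilde R)$ dominating $(K,R)$.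
   Formalization: The processes X^n generating K (and K̃) are taken to be adapted, and in NA^r the dominating R̃ is required to have measurable returns: R̃_{t+1}(α) is a.s. equal to an F_{t+1}-measurable variable for every α in L^0(R_+^N;F_t). *)

(* Defs.v *)
From HB Require Import structures.
From mathcomp Require Import all_boot all_order all_algebra.
From mathcomp Require Import all_classical all_reals all_analysis.
Import Order.TTheory GRing.Theory Num.Theory.
Import numFieldNormedType.Exports.

Set Implicit Arguments.
Unset Strict Implicit.
Unset Printing Implicit Defensive.

Local Open Scope classical_set_scope.
Local Open Scope ring_scope.

Section convex_geometry.
Context {R : realType} {n : nat}.
Implicit Types (A : set 'rV[R]_n) (x y : 'rV[R]_n).

Definition nneg : set 'rV[R]_n := [set x | forall j, 0 <= x ord0 j].

Definition oppset A : set 'rV[R]_n := [set x | A (- x)].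

Definition lineality A : set 'rV[R]_n := A `&` oppset A.

(* The combinations may repeat generators and may be empty (m = 0). *)
Definition cone_hull A : set 'rV[R]_n :=
  [set y | exists m (c : 'I_m -> R) (g : 'I_m -> 'rV[R]_n),
    [/\ forall i, 0 <= c i, forall i, A (g i) & y = \sum_(i < m) c i *: g i]].

Definition aff_hull A : set 'rV[R]_n :=
  [set y | exists m (c : 'I_m -> R) (g : 'I_m -> 'rV[R]_n),
    [/\ \sum_(i < m) c i = 1, forall i, A (g i) &
        y = \sum_(i < m) c i *: g i]].

Definition relint A : set 'rV[R]_n :=
  [set x | A x /\ \forall y \near x, aff_hull A y -> A y].

End convex_geometry.

Definition financial {R : realType} {d N : nat} (A : set 'rV[R]_(d + N)) :
    set 'rV[R]_(d + N) :=
  A `&` [set y | rsubmx y = 0].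

Section market.
Context {disp : measure_display} {Omega : measurableType disp} {R : realType}.
Variables (P : probability Omega R) (T : nat) (F : nat -> set (set Omega)).

(* Everything indexed by {0, ..., T} is a function on nat of which only the
   values at t <= T are constrained and used.  F 0 is trivial in the sense of
   P, so that it may contain null sets. *)
Definition filtered_space : Prop :=
  [/\ forall t, (t <= T)%N -> sigma_algebra setT (F t),
      forall s t, (s <= t <= T)%N -> F s `<=` F t,
      F T = @measurable _ Omega &
      forall A, F 0%N A -> P A = 0%E \/ P A = 1%E].

(* When G is a sigma-algebra, the measurable sets of g_sigma_algebraType G are
   the elements of G.  For row vectors, Borel measurability is measurability of
   the coordinates. *)
Definition rvar (G : set (set Omega)) {n} (f : Omega -> 'rV[R]_n) : Prop :=
  forall j, measurable_fun [set: g_sigma_algebraType G] (fun w => f w ord0 j).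

(* Elements of L^0 are represented by measurable functions. *)
Definition L0 {n} (E : Omega -> set 'rV[R]_n) (G : set (set Omega)) :
    set (Omega -> 'rV[R]_n) :=
  [set f | rvar G f /\ {ae P, forall w, E w (f w)}].

Definition L0_proc {n} (E : set 'rV[R]_n) : set (nat -> Omega -> 'rV[R]_n) :=
  [set xi | forall t, (t <= T)%N -> L0 (fun=> E) (F t) (xi t)].

Definition cvg_prob {n} (f : nat -> Omega -> 'rV[R]_n) (g : Omega -> 'rV[R]_n) :
    Prop :=
  forall e : R, 0 < e ->
    P [set w | e < `|f k w - g w|] @[k --> \oo] --> 0%E.

Definition closed_in_probability {n} (S : set (Omega -> 'rV[R]_n)) : Prop :=
  forall (f : nat -> Omega -> 'rV[R]_n) (g : Omega -> 'rV[R]_n),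
    (forall k, S (f k)) -> L0 (fun=> setT) (F T) g -> cvg_prob f g -> S g.

Definition proc_closed_in_probability {n}
    (S : set (nat -> Omega -> 'rV[R]_n)) : Prop :=
  forall (f : nat -> nat -> Omega -> 'rV[R]_n) (g : nat -> Omega -> 'rV[R]_n),
    (forall k, S (f k)) -> L0_proc setT g ->
    (forall t, (t <= T)%N -> cvg_prob (fun k => f k t) (g t)) -> S g.

Section positions.
Context {d N : nat}.

Definition cone_process := nat -> Omega -> set 'rV[R]_(d + N).

(* A production function is defined on R_+^N only: its values at other
   arguments are junk and are never constrained. *)
Definition production_process := nat -> Omega -> 'rV[R]_N -> 'rV[R]_(d + N).

Implicit Types (K : cone_process) (Rp : production_process).
Implicit Types (xi : nat -> Omega -> 'rV[R]_(d + N)) (x : 'rV[R]_(d + N)).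

(* The generating processes are adapted. *)
Definition cone_class : set cone_process :=
  [set K | exists X : nat -> nat -> Omega -> 'rV[R]_(d + N),
    (forall n, L0_proc setT (X n)) /\
    forall t, (t <= T)%N -> {ae P, forall w,
      [/\ finite_set [set n | X n t w != 0],
          (exists n, X n t w != 0),
          K t w = cone_hull (range (fun n => X n t w)) &
          nneg `\ 0 `<=` interior (K t w)]}].

Definition production_class : set production_process :=
  [set Rp | forall t, (t <= T)%N ->
    (forall w al, nneg al -> rsubmx (Rp t w al) = 0) /\
    (forall al, nneg al -> rvar (F t) (fun w => Rp t w al))].

Definition claim xi (t : nat) (w : Omega) : 'rV[R]_N :=
  \sum_(s < t.+1) rsubmx (xi s w).

Definition strategies x K : set (nat -> Omega -> 'rV[R]_(d + N)) :=
  [set xi | L0_proc setT xi /\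
    forall t, (t <= T)%N -> {ae P, forall w,
      oppset (K t w) (xi t w) /\ nneg (claim xi t w + rsubmx x)}].

Definition terminal x Rp xi (w : Omega) : 'rV[R]_(d + N) :=
  x + \sum_(t < T.+1) xi t w +
  \sum_(t < T) Rp t.+1 w (rsubmx x + claim xi t w).

(* Random variables are identified when they agree almost surely. *)
Definition attainable x K Rp : set (Omega -> 'rV[R]_(d + N)) :=
  [set f | L0 (fun=> setT) (F T) f /\
    exists2 xi, strategies x K xi & {ae P, forall w, f w = terminal x Rp xi w}].

Definition consumption x K Rp : set (nat -> Omega -> 'rV[R]_d) :=
  [set c | L0_proc nneg c /\
    attainable x K Rp (fun w => row_mx (\sum_(t < T.+1) c t w) 0)].

Definition R1 Rp : Prop :=
  forall t, (t <= T)%N -> {ae P, forall w,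
    Rp t w 0 = 0 /\ {within nneg, continuous (Rp t w)}}.

Definition R2 K Rp : Prop :=
  forall t, (t <= T)%N ->
  forall (l : R) (al be : Omega -> 'rV[R]_N), 0 <= l <= 1 ->
    L0 (fun=> nneg) (F T) al -> L0 (fun=> nneg) (F T) be ->
    {ae P, forall w, oppset (financial (K t w))
      (l *: Rp t w (al w) + (1 - l) *: Rp t w (be w)
       - Rp t w (l *: al w + (1 - l) *: be w))}.

Definition R3 Rp : Prop :=
  exists (a : nat -> Omega -> 'rV[R]_(d + N)) (Lp : production_process),
    production_class Lp /\
    forall t, (t <= T)%N -> L0 (fun=> setT) (F T) (a t) /\
    forall (l : Omega -> R) (al : Omega -> 'rV[R]_N),
      measurable_fun [set: g_sigma_algebraType (F T)] l ->
      {ae P, forall w, 0 <= l w} ->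
      L0 (fun=> nneg) (F T) al ->
      {ae P, forall w, l w *: Lp t w (al w) = Lp t w (l w *: al w)} /\
      exists2 f, L0 (fun=> nneg) (F T) f &
        {ae P, forall w, f w = Rp t w (al w) + a t w + Lp t w (al w)}.

Definition NA K Rp : Prop :=
  attainable 0 K Rp `&` L0 (fun=> nneg) (F T) = L0 (fun=> [set 0]) (F T).

Definition D1 K Kt : Prop :=
  forall t, (t <= T)%N -> {ae P, forall w,
    financial (K t w) `\` lineality (financial (K t w))
      `<=` relint (financial (Kt t w)) /\
    K t w `<=` Kt t w}.

Definition D2 K Rp Rt : Prop :=
  forall t, (t <= T)%N -> {ae P, forall w,
    financial (K t w) (Rt t w 0) /\
    forall al, nneg al -> al != 0 ->
      relint (financial (K t w)) (Rt t w al - Rp t w al)}.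

Definition dominates Kt Rt K Rp : Prop := D1 K Kt /\ D2 K Rp Rt.

(* Measurability of w |-> Rp t w al for deterministic al does not imply that a
   random investment has a measurable return, which the definition of
   attainable claims as random variables presupposes.  Continuity (R1) implies
   it, but a dominating production process need not be continuous. *)
Definition measurable_returns Rp : Prop :=
  forall t, (t < T)%N -> forall al, L0 (fun=> nneg) (F t) al ->
    exists2 f, L0 (fun=> setT) (F t.+1) f &
      {ae P, forall w, f w = Rp t.+1 w (al w)}.

Definition NAr K Rp : Prop :=
  exists Kt Rt,
    [/\ cone_class Kt, production_class Rt, measurable_returns Rt,
        dominates Kt Rt K Rp & NA Kt Rt].

End positions.
End market.

Arguments cone_process {disp} Omega R d N.
Arguments production_process {disp} Omega R d N.

(* Main.v *)
Require Import Defs.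
From HB Require Import structures.
From mathcomp Require Import all_boot all_order all_algebra.
From mathcomp Require Import all_classical all_reals all_analysis.
From mathcomp Require Import measurable_realfun ring lra.
Import Order.TTheory GRing.Theory Num.Theory.
Import numFieldNormedType.Exports.

(* Closedness follows by descending induction on a date s: strategies whose
   components before s converge almost surely, and whose terminal values
   converge, admit a limit strategy.  Among the strategies with the same
   components before s and the same terminal value, choose one whose component
   at s has nearly minimal norm.  If these norms exploded on a non-null event,
   dividing by them (concavity of the production functions turns a rescaled
   strategy into a strategy, up to financial positions that are thrown away)
   would give in the limit a strategy with zero terminal value.  By robust no
   arbitrage such a strategy never invests and stays in the lineality spaces,
   so that multiples of it can be subtracted from the original strategies; this
   would make the component at s much smaller and contradict minimality.  Hence
   the norms are bounded along a random subsequence, the components at s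
   converge along a measurably chosen one, and the induction proceeds. *)

Set Implicit Arguments.
Unset Strict Implicit.
Unset Printing Implicit Defensive.

Local Open Scope classical_set_scope.
Local Open Scope ring_scope.

(** * Row vectors and finitely generated cones *)

(** The obstacle is that components may explode along positions that cost nothing while terminal
    values still converge, so no bound on strategies is available beforehand. Robust no-arbitrage
    only says that such positions lie in the lineality spaces; minimality of one component at a time
    is what removes them. Exact minimisers would call for a closedness result of their own. It
    suffices that no competitor of the k-th strategy gains 1 in norm except on an event of
    probability at most 2^-(k+1), since Borel-Cantelli then excludes such gains for large k.
    Division is by random integers: (R2) holds almost surely for each deterministic weight, and
    integers leave countably many weights, hence a single null set. A strategy from x divided by m
    starts from x/m, so the induction must allow initial positions that vary with the index and with
    the path. *)

Section row_vectors.
Context {R : realType}.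

Lemma coord_le_norm n (v : 'rV[R]_n) j : `|v ord0 j| <= `|v|.
Proof.
have -> : `|v| = \big[Num.max/0]_ij `|v ij.1 ij.2| by exact: mx_normrE.
by apply/bigmax_geP; right => /=; exists (ord0, j).
Qed.

Lemma norm_row_le n (v : 'rV[R]_n) (r : R) :
  0 <= r -> (forall j, `|v ord0 j| <= r) -> `|v| <= r.
Proof.
move=> r0 vr; have -> : `|v| = \big[Num.max/0]_ij `|v ij.1 ij.2| by exact: mx_normrE.
by apply/bigmax_leP; split => //= -[i j] _ /=; rewrite ord1.
Qed.

Lemma cvg_row n (u : nat -> 'rV[R]_n) (l : 'rV[R]_n) :
  (forall j, (u k ord0 j) @[k --> \oo] --> l ord0 j) -> u @ \oo --> l.
Proof.
move=> ul; apply/cvgrPdist_le => e e0.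
have : \forall k \near \oo, forall j, `|l ord0 j - u k ord0 j| <= e.
  apply: filter_forall => j; by move/cvgrPdist_le : (ul j); apply.
apply: filterS => k uk; apply: norm_row_le; first exact: ltW.
by move=> j; rewrite !mxE.
Qed.

Lemma cvg_coord n (u : nat -> 'rV[R]_n) (l : 'rV[R]_n) j :
  u @ \oo --> l -> (u k ord0 j) @[k --> \oo] --> l ord0 j.
Proof.
move=> /cvgrPdist_le ul; apply/cvgrPdist_le => e /ul; apply: filterS => k.
by apply: le_trans; have := coord_le_norm (l - u k) j; rewrite !mxE.
Qed.

Lemma rsubmx_cvg d N (u : nat -> 'rV[R]_(d + N)) (l : 'rV[R]_(d + N)) :
  u @ \oo --> l -> (rsubmx (u k)) @[k --> \oo] --> rsubmx l.
Proof.
move=> ul; apply: cvg_row => j.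
rewrite mxE; under eq_cvg do rewrite mxE; exact: cvg_coord.
Qed.

Lemma cvg_seq_sum (V : normedModType R) m (u : nat -> 'I_m -> V) (l : 'I_m -> V) :
  (forall i, u k i @[k --> \oo] --> l i) ->
  \sum_(i < m) u k i @[k --> \oo] --> \sum_(i < m) l i.
Proof.
elim: m u l => [|m IH] u l ul.
  by under eq_cvg do rewrite big_ord0; rewrite big_ord0; exact: cvg_cst.
under eq_cvg do rewrite big_ord_recl; rewrite big_ord_recl.
by apply: cvgD => //; exact: IH.
Qed.

Lemma nneg_closed n (u : nat -> 'rV[R]_n) (l : 'rV[R]_n) :
  (forall k, nneg (u k)) -> u @ \oo --> l -> nneg l.
Proof.
move=> u0 /(cvg_coord) ul j; apply: (cvgr_to_ge (ul j)).
by apply: nearW => k; exact: u0.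
Qed.

Lemma within_cvg (V W : topologicalType) (A : set V) (f : V -> W)
    (u : nat -> V) l :
  {within A, continuous f} -> (forall k, A (u k)) -> A l -> u @ \oo --> l ->
  f (u k) @[k --> \oo] --> f l.
Proof.
move=> /subspace_continuousP fc uA lA ul.
apply: (cvg_trans _ (fc _ lA)) => B /= fB.
have := ul _ fB; rewrite /= nbhs_simpl /=; apply: filterS => k; apply.
exact: uA.
Qed.

Lemma compact_seq_cluster (V : normedModType R) (A : set V) (u : nat -> V) :
  compact A -> (forall k, A (u k)) ->
  exists2 p, A p & forall e, 0 < e -> forall m, exists2 k, (m <= k)%N & `|u k - p| < e.
Proof.
move=> cA uA; have [|p [Ap clp]] := cA (u @ \oo) _.
  by exists 0%N => // k _; exact: uA.
exists p => // e e0 m.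
have []:= clp [set z | exists2 k, (m <= k)%N & z = u k] (ball p e).
- by exists m => //= k mk; exists k.
- exact: nbhsx_ballx.
move=> z [[k mk ->]] pk; exists k => //.
by rewrite distrC; move: pk; rewrite -ball_normE.
Qed.

Lemma closedP (V : normedModType R) (A : set V) :
  (forall y, (forall e, 0 < e -> exists2 z, A z & `|y - z| < e) -> A y) <-> closed A.
Proof.
split=> [cA y /= cly|cA y yA].
  apply: cA => e e0; have [z [Az]] := cly (ball y e) (nbhsx_ballx _ _ e0).
  by rewrite -ball_normE => yz; exists z.
apply: cA => B /nbhs_ballP[e /= e0 eB].
have [z Az yz] := yA _ e0; exists z; split => //; apply: eB.
by rewrite -ball_normE.
Qed.

End row_vectors.

(** * Closedness of finitely generated cones *)

Section cones.
Context {R : realType} {n : nat}.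
Implicit Types (X : nat -> 'rV[R]_n) (y z : 'rV[R]_n) (K : set 'rV[R]_n).

Definition convex_cone K : Prop :=
  [/\ K 0, forall y z, K y -> K z -> K (y + z) &
      forall (c : R) y, 0 <= c -> K y -> K (c *: y)].

Lemma convex_cone_sum K m (c : 'I_m -> 'rV[R]_n) :
  convex_cone K -> (forall i, K (c i)) -> K (\sum_(i < m) c i).
Proof. by case=> K0 KD _ Kc; apply: big_ind => // i _; exact: Kc. Qed.

(** Peeling off one generator at a time makes closedness an induction on the number of generators;
    [cone_hull_finite] links this form to [cone_hull]. *)
Fixpoint fcone m X : set 'rV[R]_n :=
  if m is m'.+1 then [set y | exists2 c : R, 0 <= c & fcone m' X (y - c *: X m')]
  else [set 0].

Lemma fcone_convex m X : convex_cone (fcone m X).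
Proof.
elim: m => [|m [K0 KD KZ]] /=.
  split=> // [y z -> ->|c y c0 ->]; first by rewrite addr0.
  by rewrite scaler0.
split=> [|y z [c c0 yc] [b b0 zb]|c y c0 [b b0 yb]].
- by exists 0 => //; rewrite scale0r subr0.
- exists (c + b); first exact: addr_ge0.
  by rewrite scalerDl opprD addrACA; exact: KD.
- exists (c * b); first exact: mulr_ge0.
  by rewrite -scalerA -scalerBr; exact: KZ.
Qed.

Lemma fcone_gen m X i : (i < m)%N -> fcone m X (X i).
Proof.
elim: m => // m IH; rewrite ltnS leq_eqVlt => /predU1P[->|/IH im] /=.
  by exists 1; rewrite ?ler01// scale1r subrr; have [] := fcone_convex m X.
by exists 0 => //; rewrite scale0r subr0.
Qed.

Lemma fcone_min m X K : convex_cone K -> (forall i, (i < m)%N -> K (X i)) ->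
  fcone m X `<=` K.
Proof.
move=> cK; elim: m => [|m IH] XK y /=; first by move=> ->; case: cK.
case=> c c0 /IH-/(_ (fun i im => XK i (ltnW im))) yK.
have [_ KD KZ] := cK; rewrite -(subrK (c *: X m) y).
by apply: KD => //; apply: KZ => //; exact: XK.
Qed.

Lemma cone_hull_convex (A : set 'rV[R]_n) : convex_cone (cone_hull A).
Proof.
split=> [|y z [m [c [g [c0 gA ->]]]] [m' [c' [g' [c0' gA' ->]]]]|b y b0 [m [c [g [c0 gA ->]]]]].
- by exists 0%N, (fun=> 0), (fun=> 0); split=> //; [case|rewrite big_ord0].
- exists (m + m')%N, (fun i => match fintype.split i with inl j => c j | inr j => c' j end),
    (fun i => match fintype.split i with inl j => g j | inr j => g' j end).
  split; [by move=> i; case: fintype.split|by move=> i; case: fintype.split|].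
  rewrite big_split_ord /=; congr (_ + _); apply: eq_bigr => i _.
    by rewrite (unsplitK (inl i)).
  by rewrite (unsplitK (inr i)).
- exists m, (fun i => b * c i), g; split=> //; first by move=> i; exact: mulr_ge0.
  by rewrite scaler_sumr; apply: eq_bigr => i _; rewrite scalerA.
Qed.

Lemma cone_hull_min (A : set 'rV[R]_n) K :
  convex_cone K -> A `<=` K -> cone_hull A `<=` K.
Proof.
move=> cK AK y [m [c [g [c0 gA ->]]]]; apply: convex_cone_sum => // i.
by have [_ _ KZ] := cK; apply: KZ => //; apply: AK.
Qed.

Lemma cone_hull_gen (A : set 'rV[R]_n) y : A y -> cone_hull A y.
Proof.
move=> Ay; exists 1%N, (fun=> 1), (fun=> y).
by split=> //; rewrite big_ord1 scale1r.
Qed.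

Lemma cone_hull_finite X m : (forall i, (m <= i)%N -> X i = 0) ->
  cone_hull (range X) = fcone m X.
Proof.
move=> X0; apply/seteqP; split.
  apply: cone_hull_min; first exact: fcone_convex.
  move=> _ [i _ <-]; have [im|/X0->] := ltnP i m; first exact: fcone_gen.
  by have [] := fcone_convex m X.
apply: fcone_min; first exact: cone_hull_convex.
by move=> i _; apply: cone_hull_gen; exists i.
Qed.

Lemma fcone_map (f : {linear 'rV[R]_n -> 'rV[R]_n}) m X z :
  fcone m (f \o X) z <-> exists2 y, fcone m X y & z = f y.
Proof.
split.
- elim: m z => [|m IH] z /=; first by move=> ->; exists 0; rewrite ?linear0.
  move=> [c c0 /IH[y yX zy]]; exists (y + c *: X m).
    by exists c => //; rewrite addrK.
  by rewrite linearD linearZ -zy subrK.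
- elim: m z => [|m IH] z /= [y]; first by move=> -> ->; rewrite linear0.
  move=> [c c0 yX] ->; exists c => //; apply: IH; exists (y - c *: X m) => //.
  by rewrite (linearB f) (linearZ_LR f).
Qed.

Definition coord_proj (g : 'rV[R]_n) j y := y - (y ord0 j / g ord0 j) *: g.

Lemma coord_proj_linear g j : linear (coord_proj g j).
Proof.
move=> a y z; rewrite /coord_proj !mxE scalerBr scalerA addrACA; congr (_ + _).
by rewrite -opprD -scalerDl mulrDl mulrA.
Qed.

HB.instance Definition _ g j :=
  GRing.isLinear.Build _ _ _ _ (coord_proj g j) (coord_proj_linear g j).

(* If [-g] lies in the closed cone [C], then [C + R_+ g] is the preimage of a
   cone with fewer generators under a projection along [g]; otherwise the
   coefficient of [g] is bounded on bounded sets. *)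
Lemma fcone_closed m X : closed (fcone m X).
Proof.
elim: m X => [|m IH] X.
  apply/closedP => y y0; apply/eqP; rewrite -normr_le0.
  apply/ler_addgt0Pr => e /y0[z -> ]; rewrite subr0 add0r; exact: ltW.
set C := fcone m X; set g := X m.
have [C0 CD CZ] : convex_cone C := fcone_convex m X.
have [Cg|nCg] := pselect (C (- g)).
  have [g0|g0] := eqVneq g 0.
    suff -> : fcone m.+1 X = C by exact: IH.
    apply/seteqP; split=> y /=; first by rewrite -/g g0 => -[c _]; rewrite scaler0 subr0.
    by move=> Cy; exists 0 => //; rewrite scale0r subr0.
  have [j gj] : exists j, g ord0 j != 0.
    have [j gj] : exists j, ~ g ord0 j = 0.
      apply/existsNP => g0'; case/eqP: g0; apply/rowP => j; rewrite mxE; exact: g0'.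
    by exists j; apply/eqP.
  pose f : {linear 'rV[R]_n -> 'rV[R]_n} := coord_proj g j.
  have fg : f g = 0 by rewrite /f /= /coord_proj divff// scale1r subrr.
  have fE y : fcone m.+1 X y <-> fcone m (f \o X) (f y).
    split=> [[c c0 yC]|/fcone_map[z zC]].
      apply/fcone_map; exists (y - c *: g) => //.
      by rewrite linearB linearZ_LR fg scaler0 subr0.
    rewrite /f /= /coord_proj => /eqP; rewrite subr_eq addrAC => /eqP yE.
    set a := y ord0 j / g ord0 j - z ord0 j / g ord0 j.
    have {}yE : y = z + a *: g.
      by rewrite /a scalerBl addrA; exact: yE.
    (* A negative multiple of [g] is a nonnegative multiple of [- g], which lies in [C], so the
       coefficient 0 works. *)
    have [a0|a0] := leP 0 a; first by exists a => //; rewrite yE addrK.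
    exists 0 => //; rewrite scale0r subr0 yE; apply: CD => //.
    by rewrite -[a]opprK scaleNr -scalerN; apply: CZ => //; rewrite oppr_ge0 ltW.
  apply/closedP => y yl; apply/fE; move/closedP : (IH (f \o X)); apply => e e0.
  (* A Lipschitz constant of the projection [coord_proj g j]. *)
  pose c := 1 + `|g| / `|g ord0 j|.
  have c0 : 0 < c by rewrite ltr_wpDr// divr_ge0.
  have [z zX yz] := yl (e / c) (divr_gt0 e0 c0).
  exists (f z); first exact/fE.
  rewrite -linearB /f /= /coord_proj (le_lt_trans (ler_normB _ _))//.
  rewrite normrZ normrM normfV mulrAC -mulrA.
  rewrite (@le_lt_trans _ _ (`|y - z| * c))//.
    rewrite mulrDr mulr1 lerD2l [X in X <= _]mulrC -mulrA [_^-1 * _]mulrC.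
    rewrite mulrCA ler_wpM2r// ?divr_ge0//; exact: coord_le_norm.
  by rewrite -ltr_pdivlMr.
(* [C] is closed and misses [- g], so its distance to [- g] is positive. *)
have [e e0 Ce] : exists2 e, 0 < e & forall z, C z -> e <= `|z + g|.
  have /closedP/(_ (- g)) cC := IH X; apply: contrapT => nC.
  apply/nCg/cC => e e0; apply: contrapT => nCe; apply: nC; exists e => // z Cz.
  rewrite leNgt; apply/negP => ze; apply: nCe; exists z => //.
  by rewrite -normrN opprB opprK.
apply/closedP => y yl.
have /choice[u uP] : forall k, exists zc : 'rV[R]_n * R,
    [/\ 0 <= zc.2, C (zc.1 - zc.2 *: g) & `|y - zc.1| < k.+1%:R^-1].
  move=> k; have [z [c c0 zc] yz] := yl k.+1%:R^-1 ltac:(by rewrite invr_gt0).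
  by exists (z, c).
(* If u - c g lies in [C], dividing by c and using the distance [e] gives c e <= |u|; points u
   within 1 of [y] therefore have c <= M. *)
pose M := (`|y| + 1) / e.
have uM k : `[0, M]%classic (u k).2.
  have [c0 uC yu] := uP k; rewrite /= in_itv /= c0 /= /M ler_pdivlMr//.
  have {}yu : `|(u k).1| <= `|y| + 1.
    rewrite -[(u k).1](subrK y) addrC (le_trans (ler_normD _ _))// lerD2l distrC.
    by rewrite (le_trans (ltW yu))// invf_le1// ler1n.
  have [->|cn0] := eqVneq (u k).2 0; first by rewrite mul0r (le_trans _ yu).
  have cp : 0 < (u k).2 by rewrite lt0r cn0.
  apply: le_trans yu; rewrite mulrC -ler_pdivlMr//.
  have := Ce _ (CZ (u k).2^-1 _ ltac:(by rewrite invr_ge0) uC).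
  by rewrite scalerBr scalerA mulVf// scale1r subrK normrZ ger0_norm ?invr_ge0// mulrC.
have [c /=] := compact_seq_cluster (@segment_compact R 0 M) uM.
rewrite in_itv /= => /andP[c0 _] cu; exists c => //.
move/closedP : (IH X); apply => b b0.
pose b' := b / (2 * (`|g| + 1)).
have g1 : 0 < `|g| + 1 by rewrite ltr_wpDl.
have b'0 : 0 < b' by rewrite divr_gt0// mulr_gt0.
have [m' m'b] : exists m', m'.+1%:R^-1 < b / 2.
  have [k _ kb] := near_infty_natSinv_lt (PosNum (divr_gt0 b0 (@ltr0Sn R 1))).
  by exists k; exact: (kb k (leqnn _)).
have [k m'k uc] := cu _ b'0 m'.
have [_ uC yu] := uP k; exists ((u k).1 - (u k).2 *: g) => //.
have -> : y - c *: X m - ((u k).1 - (u k).2 *: g) =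
    (y - (u k).1) + ((u k).2 - c) *: g by apply/rowP => i; rewrite !mxE; ring.
rewrite (le_lt_trans (ler_normD _ _))// [ltRHS]splitr ltr_leD//.
  rewrite (lt_trans yu)// (le_lt_trans _ m'b)// lef_pV2 ?posrE//.
  by rewrite ler_nat ltnS.
rewrite normrZ (@le_trans _ _ (b' * `|g|))//; first by rewrite ler_wpM2r// ltW.
rewrite /b' invfM mulrA -mulrA ler_piMr//; first by rewrite divr_ge0// ltW.
by rewrite mulrC ler_pdivrMr// mul1r lerDl.
Qed.


(** For small b the point e + b y stays in a ball around [e] inside [K]; homogeneity rescales it by
    1/b. *)
Lemma interior_cone_absorbs K e y : convex_cone K -> K^° e ->
  exists2 c : R, 0 < c & K (c *: e + y).
Proof.
move=> [_ _ KZ] /nbhs_ballP[r /= r0 rK].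
pose b := r / (`|y| + 1).
have y1 : 0 < `|y| + 1 by rewrite ltr_wpDl.
have b0 : 0 < b by rewrite divr_gt0.
exists b^-1; first by rewrite invr_gt0.
have -> : b^-1 *: e + y = b^-1 *: (e + b *: y).
  by rewrite scalerDr scalerA mulVf ?gt_eqF// scale1r.
apply: KZ; first by rewrite invr_ge0 ltW.
apply: rK; rewrite -ball_normE /= opprD addrA subrr sub0r normrN normrZ gtr0_norm//.
by rewrite /b mulrAC ltr_pdivrMr// ltr_pM2l// ltrDl.
Qed.

End cones.

Section financial_cone.
Context {R : realType} {d N : nat}.
Implicit Types (K : set 'rV[R]_(d + N)) (y z e : 'rV[R]_(d + N)).

(** A financial direction [e] interior to [K] makes the affine hull of [financial K] the whole space
    of financial positions. A relative interior point then has room in every financial direction, in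
    particular along [- e]. *)
Lemma relint_financial K e y : convex_cone K -> rsubmx e = 0 -> K^° e ->
  relint (financial K) y -> exists m, K (y - m.+1%:R^-1 *: e).
Proof.
move=> cK eF Ke [[Ky yF] /nbhs_ballP[r /= r0 rK]].
have [K0 KD KZ] := cK.
have Kee : K e by exact: interior_subset.
have affK z : rsubmx z = 0 -> aff_hull (financial K) z.
  move=> zF; have [c c0 Kc] := interior_cone_absorbs z cK Ke.
  (* [z] is the difference of c e + z and c e; the third point, 0, only brings the total weight to
     1. *)
  exists 3%N, (fun i : 'I_3 => nth 0 [:: 1; -1; 1] i),
    (fun i : 'I_3 => nth 0 [:: c *: e + z; c *: e; 0] i).
  rewrite !big_ord_recl !big_ord0 /=; split.
  - by rewrite addr0 addrA subrr add0r.
  - have eFc : rsubmx (c *: e) = 0 by rewrite linearZ /= eF scaler0.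
    move=> [[|[|[|//]]] i3] /=; split => //=.
    + by rewrite linearD /= eFc zF addr0.
    + by apply: KZ => //; exact: ltW.
    + by rewrite linear0.
  - by rewrite scaler0 !addr0 scale1r scaleN1r addrAC subrr add0r.
have [m mr] : exists m, m.+1%:R^-1 < r / (`|e| + 1).
  have e1 : 0 < `|e| + 1 by rewrite ltr_wpDl.
  have [k _ kb] := near_infty_natSinv_lt (PosNum (divr_gt0 r0 e1)).
  by exists k; exact: (kb k (leqnn _)).
exists m; suff [] : financial K (y - m.+1%:R^-1 *: e) by [].
apply: rK.
  rewrite -ball_normE /= opprB addrCA subrr addr0 normrZ ger0_norm ?invr_ge0//.
  apply: (@le_lt_trans _ _ (m.+1%:R^-1 * (`|e| + 1))).
    by rewrite ler_wpM2l ?invr_ge0// lerDl.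
  by rewrite -ltr_pdivlMr// ltr_wpDl.
by apply: affK; rewrite linearB /= yF linearZ /= eF scaler0 subr0.
Qed.

End financial_cone.

(** * Measurable selection and random vectors *)

Section measurable_formulas.
Context d (T : measurableType d).
Implicit Types (A B : T -> Prop).

Lemma mset_and A B : measurable [set w | A w] -> measurable [set w | B w] ->
  measurable [set w | A w /\ B w].
Proof. exact: measurableI. Qed.

Lemma mset_not A : measurable [set w | A w] -> measurable [set w | ~ A w].
Proof. exact: measurableC. Qed.

Lemma mset_const (Q : Prop) : measurable [set w : T | Q].
Proof.
have [q|nq] := pselect Q.
  by rewrite (_ : [set w | Q] = setT); [exact: measurableT|apply/seteqP; split].
by rewrite (_ : [set w | Q] = set0); [exact: measurable0|apply/seteqP; split].
Qed.

Lemma mset_exists (I : countType) (A : I -> T -> Prop) :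
  (forall i, measurable [set w | A i w]) -> measurable [set w | exists i, A i w].
Proof.
move=> mA; rewrite (_ : [set w | _] =
    \bigcup_k (if unpickle k is Some i then [set w | A i w] else set0)).
  by apply: bigcupT_measurable => k; case: unpickle.
apply/seteqP; split=> w /=.
  by move=> [i Ai]; exists (pickle i) => //; rewrite pickleK.
by move=> [k _]; case: unpickle => // i; exists i.
Qed.

Lemma mset_forall (I : countType) (A : I -> T -> Prop) :
  (forall i, measurable [set w | A i w]) -> measurable [set w | forall i, A i w].
Proof.
move=> mA; rewrite (_ : [set w | _] = [set w | ~ exists i, ~ A i w]).
  by apply: mset_not; apply: mset_exists => i; exact: mset_not.
apply/seteqP; split=> w /=; first by move=> Aw [i]; apply.
by move=> nA i; apply: contrapT => nAi; apply: nA; exists i.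
Qed.

Lemma mset_glue (I : countType) (V : T -> I) (A : I -> T -> Prop) :
  (forall i, measurable [set w | V w = i]) ->
  (forall i, measurable [set w | A i w]) -> measurable [set w | A (V w) w].
Proof.
move=> mV mA; rewrite (_ : [set w | _] = [set w | exists i, V w = i /\ A i w]).
  by apply: mset_exists => i; exact: mset_and.
apply/seteqP; split=> w /=; first by move=> Aw; exists (V w).
by move=> [i [<-]].
Qed.

Lemma mset_lt {R : realType} (f g : T -> R) : measurable_fun setT f ->
  measurable_fun setT g -> measurable [set w | f w < g w].
Proof.
move=> mf mg; have := measurable_fun_ltr mf mg measurableT (I : measurable [set true]).
rewrite setTI (_ : _ @^-1` _ = [set w | f w < g w])//.
Qed.

Lemma mset_le {R : realType} (f g : T -> R) : measurable_fun setT f ->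
  measurable_fun setT g -> measurable [set w | f w <= g w].
Proof.
move=> mf mg; have := measurable_fun_ler mf mg measurableT (I : measurable [set true]).
rewrite setTI (_ : _ @^-1` _ = [set w | f w <= g w])//.
Qed.

Lemma measurable_fun_glue {R : realType} (I : countType) (V : T -> I)
    (f : I -> T -> R) :
  (forall i, measurable [set w | V w = i]) ->
  (forall i, measurable_fun setT (f i)) -> measurable_fun setT (fun w => f (V w) w).
Proof.
move=> mV mf _ B mB; rewrite setTI.
apply: (@mset_glue I V (fun i w => B (f i w)) mV) => i.
by have := mf i measurableT B mB; rewrite setTI.
Qed.

End measurable_formulas.

Section least.
Implicit Types (P : nat -> Prop).

(** Total, with default [k]: random indices built from it are defined and measurable on the whole
    space, with no exceptional event. *)
Definition least P (k : nat) : nat :=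
  if pselect (exists n, `[< P n >]) is left h then ex_minn h else k.

Lemma leastP P k : (exists n, P n) -> P (least P k).
Proof.
rewrite /least; case: pselect => [h _|nP [n Pn]].
  by case: ex_minnP => m /asboolP.
by exfalso; apply: nP; exists n; apply/asboolP.
Qed.

Lemma least_none P k : ~ (exists n, P n) -> least P k = k.
Proof.
rewrite /least; case: pselect => // -[n Pn] nP; exfalso; apply: nP.
by exists n; apply/asboolP.
Qed.

Lemma least_min P k n : P n -> (least P k <= n)%N.
Proof.
rewrite /least; case: pselect => [h Pn|nP Pn].
  by case: ex_minnP => m _; apply; apply/asboolP.
by exfalso; apply: nP; exists n; apply/asboolP.
Qed.

Lemma least_eq P k j : least P k = j <->
  (P j /\ forall i, (i < j)%N -> ~ P i) \/ (~ (exists n, P n) /\ k = j).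
Proof.
split.
  move=> <-; have [eP|nP] := pselect (exists n, P n); last first.
    by right; rewrite least_none.
  left; split; first exact: leastP.
  by move=> i; rewrite ltnNge => il Pi; move: il; rewrite least_min.
move=> [[Pj jP]|[nP <-]]; last exact: least_none.
apply/eqP; rewrite eqn_leq least_min//= leqNgt; apply/negP => /jP; apply.
by apply: leastP; exists j.
Qed.

Lemma measurable_least d (T : measurableType d) (P : T -> nat -> Prop) k j :
  (forall n, measurable [set w | P w n]) -> measurable [set w | least (P w) k = j].
Proof.
move=> mP; rewrite (_ : [set w | _] =
   [set w | P w j /\ forall i, (i < j)%N -> ~ P w i] `|`
   [set w | ~ (exists n, P w n) /\ k = j]); last first.
  by apply/seteqP; split=> w /= /least_eq.
apply: measurableU; apply: mset_and => //.
- apply: mset_forall => i.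
  have [ij|ij] := ltnP i j.
    rewrite (_ : [set w | _] = [set w | ~ P w i]); first exact: mset_not.
    by apply/seteqP; split=> w /=; [apply|].
  rewrite (_ : [set w | _] = setT); first exact: measurableT.
  by apply/seteqP; split=> w //= _.
- by apply: mset_not; exact: mset_exists.
- exact: mset_const.
Qed.

End least.

(** * An explicit, hence measurable, choice of a convergent subsequence *)

Section cluster_selection.
Context {R : realType} {n : nat}.
Implicit Types (v : nat -> 'rV[R]_n) (A : set nat).

Definition inf_many A : Prop := forall m, exists2 k, (m <= k)%N & A k.

Definition rat_row i : 'rV[R]_n := map_mx ratr (odflt (0 : 'rV[rat]_n) (unpickle i)).

Lemma rat_row_dense (p : 'rV[R]_n) r : 0 < r -> exists i, `|p - rat_row i| < r.
Proof.
move=> r0; have /choice[q qP] : forall j, exists q : rat, `|p ord0 j - ratr q| <= r / 2.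
  move=> j; have [|q] := @rat_in_itvoo R (p ord0 j - r / 2) (p ord0 j + r / 2).
    by lra.
  rewrite in_itv /= => /andP[q1 q2]; exists q.
  by rewrite ler_norml; apply/andP; split; lra.
exists (pickle (\row_j q j)); rewrite /rat_row pickleK /=.
apply: (@le_lt_trans _ _ (r / 2)); last by lra.
apply: norm_row_le; first by lra.
by move=> j; rewrite !mxE.
Qed.

(* Nested index sets: at stage [k] keep the indices whose terms fall in the
   first ball of radius [1/(k+1)] with rational centre visited infinitely often. *)
Fixpoint nested_indices v k : set nat :=
  if k is k'.+1 then
    let B i := nested_indices v k' `&` [set m | `|v m - rat_row i| < k.+1%:R^-1] in
    B (least (fun i => inf_many (B i)) 0)
  else setT.

Definition cluster_index v k := least (fun m => (k <= m)%N /\ nested_indices v k m) k.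

Lemma cluster_index_ge v k : (k <= cluster_index v k)%N.
Proof.
have [h|h] := pselect (exists m, (k <= m)%N /\ nested_indices v k m).
  by have [] := leastP k h.
by rewrite /cluster_index least_none.
Qed.

(** The induction carries boundedness along: infinitely many bounded terms of one stage cluster at
    some [p], and a ball with rational centre near [p] captures infinitely many of them. *)
Lemma nested_indices_bounded v k : (exists M, inf_many [set m | `|v m| <= M]) ->
  exists M, inf_many (nested_indices v k `&` [set m | `|v m| <= M]).
Proof.
move=> vM; elim: k => [|k [M kM]] /=.
  by have [M vM'] := vM; exists M => m; have [j mj ?] := vM' m; exists j.
set B := fun i => nested_indices v k `&` [set m | `|v m - rat_row i| < k.+2%:R^-1].
suff /(leastP 0) : exists i, inf_many (B i).
  (* The new bound comes from the ball just chosen, whose radius is at most 1. *)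
  set i := least _ _ => iB; exists (`|rat_row i| + 1) => m.
  have [j mj [jk /= ji]] := iB m; exists j => //; split => //=.
  rewrite -[v j](subrK (rat_row i)) addrC (le_trans (ler_normD _ _))// lerD2l.
  by rewrite (le_trans (ltW ji))// invf_le1// ler1n.
have /choice[s sP] : forall m, exists j, (m <= j)%N /\ nested_indices v k j /\ `|v j| <= M.
  by move=> m; have [j mj [? ?]] := kM m; exists j.
have cM : compact [set p : 'rV[R]_n | `|p| <= M].
  apply: bounded_closed_compact.
    by exists M; split; [exact: num_real|move=> x Mx p /= /le_trans; apply; exact: ltW].
  apply: closed_comp (@closed_le R M) => p _; exact: norm_continuous.
have [j|p _ pcl] := compact_seq_cluster (u := v \o s) cM.
  by have [_ []] := sP j.
have r0 : 0 < k.+2%:R^-1 / 2 :> R by rewrite divr_gt0// invr_gt0.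
have [i pi] := rat_row_dense p r0; exists i => m.
have [j mj vp] := pcl _ r0 m; have [js [sk _]] := sP j; exists (s j).
  exact: leq_trans js.
split => //=; rewrite -(subrK p (v _)) -addrA (le_lt_trans (ler_normD _ _))//.
by rewrite [ltRHS]splitr ltrD.
Qed.

Lemma nested_indices_sub v j k : (j <= k)%N -> nested_indices v k `<=` nested_indices v j.
Proof.
elim: k => [|k IH]; first by rewrite leqn0 => /eqP ->.
by rewrite leq_eqVlt => /predU1P[->//|/IH jk] m [/jk].
Qed.

(** From stage k+1 on, all selected terms lie in one ball of radius 1/(k+2); this gives the Cauchy
    property without naming the limit. *)
Lemma cluster_index_cvg v : (exists M, inf_many [set m | `|v m| <= M]) ->
  cvgn (v \o cluster_index v).
Proof.
move=> vM; apply: cauchy_cvg; apply: cauchy_exP => e e0.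
have [k ke] : exists k, k.+2%:R^-1 < e.
  have [k _ kb] := near_infty_natSinv_lt (PosNum e0).
  by exists k; exact: (kb k.+1 (leqnSn _)).
set B := fun i => nested_indices v k `&` [set m | `|v m - rat_row i| < k.+2%:R^-1].
exists (rat_row (least (fun i => inf_many (B i)) 0)).
exists k.+1 => // j /= kj.
have [M jM] := nested_indices_bounded j vM.
have [//|_ ] := @leastP (fun m => (j <= m)%N /\ nested_indices v j m) j.
  by have [m ? [? _]] := jM j; exists m.
move=> /(nested_indices_sub kj)[_ /= vk].
rewrite -ball_normE /= distrC; exact: lt_trans ke.
Qed.

End cluster_selection.

(** * Cone membership through rational coefficients *)

Section rational_combinations.
Context {R : realType} {n : nat}.
Implicit Types (X : nat -> 'rV[R]_n) (y : 'rV[R]_n).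

Lemma fcone_rat_approx m X y e : fcone m X y -> 0 < e ->
  exists2 c : seq rat, size c = m & `|y - \sum_(i < m) `|ratr c`_i| *: X i| < e.
Proof.
elim: m y e => [|m IH] y e /=.
  by move=> -> e0; exists [::] => //; rewrite big_ord0 subr0 normr0.
move=> [a a0 ya] e0; have e20 : 0 < e / 2 by lra.
have [c cm yc] := IH _ _ ya e20.
have X0 : 0 < `|X m| + 1 by rewrite ltr_wpDl.
have [|q] := @rat_in_itvoo R a (a + e / 2 / (`|X m| + 1)).
  by rewrite ltrDl divr_gt0.
rewrite in_itv /= => /andP[aq qa]; exists (rcons c q); first by rewrite size_rcons cm.
rewrite big_ord_recr /= nth_rcons cm ltnn eqxx.
under eq_bigr => i _ do rewrite nth_rcons cm ltn_ord.
rewrite ger0_norm; last by rewrite (le_trans a0)// ltW.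
set S := \sum_(i < m) _ in yc *.
have -> : y - (S + ratr q *: X m) = (y - a *: X m - S) - (ratr q - a) *: X m.
  by apply/rowP => i; rewrite !mxE; ring.
rewrite (le_lt_trans (ler_normB _ _))// [ltRHS]splitr ltr_leD// normrZ.
rewrite gtr0_norm ?subr_gt0//.
apply: (@le_trans _ _ (e / 2 / (`|X m| + 1) * `|X m|)).
  by rewrite ler_wpM2r// lerBlDl ltW.
by rewrite mulrAC ler_pdivrMr// ler_wpM2l ?lerDl// ltW.
Qed.

(** Turns membership in a random cone into a countable formula. Absolute values of rationals encode
    nonnegative coefficients, and closedness of the cone turns approximation to every precision into
    membership. As [m] does not occur in the formula, the number of generators may be random. *)
Lemma cone_hull_ratP m X y : (forall i, (m <= i)%N -> X i = 0) ->
  (forall k, exists c : seq rat,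
    `|y - \sum_(i < size c) `|ratr c`_i| *: X i| < k.+1%:R^-1) <->
  cone_hull (range X) y.
Proof.
move=> X0; split; last first.
  rewrite (cone_hull_finite X0) => yX k.
  have [|c cm yc] := @fcone_rat_approx m X y k.+1%:R^-1 yX.
    by rewrite invr_gt0.
  by exists c; rewrite cm.
move=> yX; have /closedP := @fcone_closed R n m X; rewrite -(cone_hull_finite X0).
apply=> e e0.
have [k _ ke] := near_infty_natSinv_lt (PosNum e0).
have [c yc] := yX k; exists (\sum_(i < size c) `|ratr c`_i| *: X i).
  have cX := @cone_hull_convex R n (range X).
  apply: convex_cone_sum => // i; have [_ _ KZ] := cX; apply: KZ => //.
  by apply: cone_hull_gen; exists i.
exact: lt_trans yc (ke k (leqnn k)).
Qed.

Lemma finite_support_bounded X : finite_set [set i | X i != 0] ->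
  exists m, forall i, (m <= i)%N -> X i = 0.
Proof.
move=> /finite_seqP[s sE]; exists (\max_(i <- s) i).+1 => i im.
apply: contrapT => /eqP Xi; have : [set` s] i by rewrite -sE.
by move=> /= si; have := @leq_bigmax_seq _ s xpredT id i si isT; rewrite leqNgt im.
Qed.

End rational_combinations.

(** * Random vectors and random indices *)

Section random_vectors.
Context {disp : measure_display} {Omega : measurableType disp} {R : realType}.
Implicit Types (G : set (set Omega)).

Lemma gmeas_mono G G' : G `<=` G' ->
  G.-sigma.-measurable `<=` G'.-sigma.-measurable.
Proof. by move=> GG'; exact: sub_sigma_algebra2. Qed.

Lemma gmfun_mono G G' (f : Omega -> R) : G `<=` G' ->
  measurable_fun [set: g_sigma_algebraType G] f ->
  measurable_fun [set: g_sigma_algebraType G'] f.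
Proof. by move=> GG' mf _ B mB; exact: (gmeas_mono GG') (mf measurableT B mB). Qed.

Section fixed_sigma_algebra.
Variable G : set (set Omega).

Lemma rvar_mono G' n (f : Omega -> 'rV[R]_n) : G `<=` G' -> rvar G f -> rvar G' f.
Proof. by move=> GG' mf j; exact: gmfun_mono (mf j). Qed.

Lemma rvar_cst n (c : 'rV[R]_n) : rvar G (fun=> c).
Proof. by move=> j; exact: measurable_cst. Qed.

Lemma rvarD n (f g : Omega -> 'rV[R]_n) :
  rvar G f -> rvar G g -> rvar G (fun w => f w + g w).
Proof.
move=> mf mg j; rewrite (_ : (fun w => _) = (fun w => f w ord0 j + g w ord0 j)).
  exact: measurable_funD.
by apply/funext => w; rewrite mxE.
Qed.

Lemma rvarZ n (l : Omega -> R) (f : Omega -> 'rV[R]_n) :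
  measurable_fun [set: g_sigma_algebraType G] l -> rvar G f ->
  rvar G (fun w => l w *: f w).
Proof.
move=> ml mf j; rewrite (_ : (fun w => _) = (fun w => l w * f w ord0 j)).
  exact: measurable_funM.
by apply/funext => w; rewrite mxE.
Qed.

Lemma rvarN n (f : Omega -> 'rV[R]_n) : rvar G f -> rvar G (fun w => - f w).
Proof.
move=> mf j; rewrite (_ : (fun w => _) = (fun w => - f w ord0 j)).
  exact: measurable_funN.
by apply/funext => w; rewrite mxE.
Qed.

Lemma rvarB n (f g : Omega -> 'rV[R]_n) :
  rvar G f -> rvar G g -> rvar G (fun w => f w - g w).
Proof. by move=> mf mg; apply: rvarD => //; exact: rvarN. Qed.

Lemma rvar_sum n m (f : 'I_m -> Omega -> 'rV[R]_n) :
  (forall i, rvar G (f i)) -> rvar G (fun w => \sum_(i < m) f i w).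
Proof.
elim: m f => [|m IH] f mf.
  rewrite (_ : (fun w => _) = (fun=> 0)); first exact: rvar_cst.
  by apply/funext => w; rewrite big_ord0.
rewrite (_ : (fun w => _) = (fun w => f ord0 w + \sum_(i < m) f (lift ord0 i) w)).
  by apply: rvarD => //; exact: IH.
by apply/funext => w; rewrite big_ord_recl.
Qed.

Lemma rvar_rsubmx d N (f : Omega -> 'rV[R]_(d + N)) :
  rvar G f -> rvar G (fun w => rsubmx (f w)).
Proof.
move=> mf j; rewrite (_ : (fun w => _) = (fun w => f w ord0 (rshift d j))).
  exact: mf.
by apply/funext => w; rewrite mxE.
Qed.

Lemma rvar_row_mx0 d N (f : Omega -> 'rV[R]_d) :
  rvar G f -> rvar G (fun w => row_mx (f w) (0 : 'rV[R]_N)).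
Proof.
move=> mf j; case: (fintype.split_ordP j) => i ->.
  rewrite (_ : (fun w => _) = (fun w => f w ord0 i)); first exact: mf.
  by apply/funext => w; rewrite row_mxEl.
rewrite (_ : (fun w => _) = (fun=> 0)); first exact: measurable_cst.
by apply/funext => w; rewrite row_mxEr mxE.
Qed.

Lemma rvar_glue (I : countType) n (V : Omega -> I) (f : I -> Omega -> 'rV[R]_n) :
  (forall i, G.-sigma.-measurable [set w | V w = i]) ->
  (forall i, rvar G (f i)) -> rvar G (fun w => f (V w) w).
Proof.
move=> mV mf j.
exact: (@measurable_fun_glue _ (g_sigma_algebraType G) R I V
  (fun i w => f i w ord0 j) mV (fun i => mf i j)).
Qed.

Lemma rvar_if (A : set Omega) n (f g : Omega -> 'rV[R]_n) :
  G.-sigma.-measurable A -> rvar G f -> rvar G g ->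
  rvar G (fun w => if `[< A w >] then f w else g w).
Proof.
move=> mA mf mg; apply: (@rvar_glue bool n (fun w => `[< A w >])
  (fun b w => if b then f w else g w)); last by case.
case; [move: mA|move: (measurableC mA)]; congr (_ _);
  apply/seteqP; split=> w /=; try by move/asboolP.
by move=> /asboolF.
Qed.

Lemma rvar_norm n (f : Omega -> 'rV[R]_n) :
  rvar G f -> measurable_fun [set: g_sigma_algebraType G] (fun w => `|f w|).
Proof.
move=> mf; rewrite (_ : (fun w => _) =
    (fun w => \big[Num.max/0]_(ij : 'I_1 * 'I_n) `|f w ij.1 ij.2|)); last first.
  by apply/funext => w; exact: mx_normrE.
elim: (index_enum _) => [|[i j] s IH].
  rewrite (_ : (fun w => _) = (fun=> 0)); first exact: measurable_cst.
  by apply/funext => w; rewrite big_nil.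
rewrite (_ : (fun w => _) = (fun w => Num.max `|f w i j|
   (\big[Num.max/0]_(ij <- s) `|f w ij.1 ij.2|))); last first.
  by apply/funext => w; rewrite big_cons.
apply: measurable_maxr => //; rewrite ord1.
by apply: measurableT_comp => //; exact: mf.
Qed.

(** Coordinatewise upper limits are measurable everywhere, so the event of convergence need not be
    isolated; they give the limit wherever it exists. *)
Lemma rvar_lim n (f : nat -> Omega -> 'rV[R]_n) : (forall k, rvar G (f k)) ->
  exists2 g, rvar G g & forall w l, f k w @[k --> \oo] --> l -> g w = l.
Proof.
move=> mf.
exists (fun w => \row_j fine (limn_esup (fun k => (f k w ord0 j)%:E))).
  move=> j; rewrite (_ : (fun w => _) =
    (fun w => fine (limn_esup (fun k => (f k w ord0 j)%:E)))); last first.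
    by apply/funext => w; rewrite mxE.
  apply: (measurableT_comp (f := fine)); first exact: fine_measurable.
  apply: (@measurable_fun_limn_esup _ (g_sigma_algebraType G) R setT
    (fun k w => (f k w ord0 j)%:E)) => k.
  by apply/measurable_EFinP; exact: mf.
move=> w l fl; apply/rowP => j; rewrite mxE.
have fj : (f k w ord0 j)%:E @[k --> \oo] --> (l ord0 j)%:E.
  by apply: cvg_EFin; [exact: nearW|exact: cvg_coord].
by rewrite is_cvg_limn_esupE; [move/cvg_lim : fj => ->|apply/cvg_ex; exists (l ord0 j)%:E].
Qed.

Lemma measurable_inf_many (A : Omega -> set nat) :
  (forall m, G.-sigma.-measurable [set w | A w m]) ->
  G.-sigma.-measurable [set w | inf_many (A w)].
Proof.
move=> mA; apply: (@mset_forall _ (g_sigma_algebraType G)) => m.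
rewrite (_ : [set w | _] = [set w | exists k, (m <= k)%N /\ A w k]).
  apply: (@mset_exists _ (g_sigma_algebraType G)) => k.
  apply: (@mset_and _ (g_sigma_algebraType G)) => //.
  exact: (@mset_const _ (g_sigma_algebraType G)).
by apply/seteqP; split=> w /= [k]; [exists k|case=> *; exists k].
Qed.

Lemma measurable_nested_indices n (f : nat -> Omega -> 'rV[R]_n) k m :
  (forall k, rvar G (f k)) ->
  G.-sigma.-measurable [set w | nested_indices (f^~ w) k m].
Proof.
move=> mf; elim: k m => [|k IH] m /=; first exact: (@mset_const _ (g_sigma_algebraType G)).
have mB i j : G.-sigma.-measurable [set w |
    (nested_indices (f^~ w) k `&` [set m | `|f m w - rat_row i| < k.+2%:R^-1]) j].
  apply: (@mset_and _ (g_sigma_algebraType G)) => //.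
  apply: (@mset_lt _ (g_sigma_algebraType G)); last exact: measurable_cst.
  by apply: rvar_norm; apply: rvarB => //; exact: rvar_cst.
pose B i w := nested_indices (f^~ w) k `&` [set m | `|f m w - rat_row i| < k.+2%:R^-1].
apply: (@mset_glue _ (g_sigma_algebraType G) nat
  (fun w => least (fun i => inf_many (B i w)) 0) (fun i w => B i w m)) => i; last exact: mB.
apply: (@measurable_least _ (g_sigma_algebraType G)) => j.
by apply: measurable_inf_many => m'; exact: mB.
Qed.

Lemma measurable_subsequence n (f : nat -> Omega -> 'rV[R]_n) :
  (forall k, rvar G (f k)) -> exists tau : nat -> Omega -> nat,
  [/\ forall k j, G.-sigma.-measurable [set w | tau k w = j],
      forall k w, (k <= tau k w)%N &
      forall w, (exists M, inf_many [set m | `|f m w| <= M]) ->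
        cvgn (fun k => f (tau k w) w)].
Proof.
move=> mf; exists (fun k w => cluster_index (f^~ w) k); split.
- move=> k j; apply: (@measurable_least _ (g_sigma_algebraType G)) => m.
  apply: (@mset_and _ (g_sigma_algebraType G)).
    exact: (@mset_const _ (g_sigma_algebraType G)).
  exact: measurable_nested_indices.
- by move=> k w; exact: cluster_index_ge.
- by move=> w; exact: cluster_index_cvg.
Qed.

Lemma measurable_cone_hull n (X : nat -> Omega -> 'rV[R]_n) (y : Omega -> 'rV[R]_n) :
  (forall i, rvar G (X i)) -> rvar G y ->
  exists2 A, G.-sigma.-measurable A & forall w,
    finite_set [set i | X i w != 0] -> (A w <-> cone_hull (range (X^~ w)) (y w)).
Proof.
move=> mX my; exists [set w | forall m, exists c : seq rat,
    `|y w - \sum_(i < size c) `|ratr c`_i| *: X i w| < m.+1%:R^-1].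
  apply: (@mset_forall _ (g_sigma_algebraType G)) => m.
  apply: (@mset_exists _ (g_sigma_algebraType G)) => c.
  apply: (@mset_lt _ (g_sigma_algebraType G)); last exact: measurable_cst.
  apply: rvar_norm; apply: rvarB => //; apply: rvar_sum => i.
  by apply: rvarZ => //; exact: measurable_cst.
by move=> w /finite_support_bounded[M XM]; rewrite -(cone_hull_ratP _ XM).
Qed.

End fixed_sigma_algebra.
End random_vectors.

(** * Almost sure subsequences and near-minimal random variables *)

Section convergence_in_probability.
Context {disp : measure_display} {Omega : measurableType disp} {R : realType}.
Variable P : probability Omega R.

Lemma borel_cantelli_ae (F : nat -> set Omega) : (forall k, measurable (F k)) ->
  (forall k, (P (F k) <= (1 / (2 ^ k.+1)%:R)%:E)%E) ->
  {ae P, forall w, exists m, forall k, (m <= k)%N -> ~ F k w}.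
Proof.
move=> mF PF; exists (lim_sup_set F); split.
- apply: bigcap_measurable => // k _.
  by apply: bigcup_measurable => j /= _; exact: mF.
- apply: lim_sup_set_cvg0 => //; apply: (@le_lt_trans _ _ 1%:E); last exact: ltry.
  have := @epsilon_trick0 R 1 xpredT ler01; apply: le_trans.
  by apply: lee_nneseries => // k _; exact: PF.
- move=> w /= nF m _; apply: contrapT => nm; apply: nF; exists m => k mk Fk.
  by apply: nm; exists k.
Qed.

(** One subsequence serves a finite family, so that the values at all dates converge together. *)
Lemma cvg_prob_subsequence (I : finType) n (f : I -> nat -> Omega -> 'rV[R]_n)
    (g : I -> Omega -> 'rV[R]_n) :
  (forall i k, measurable_fun setT (fun w => `|f i k w - g i w|)) ->
  (forall i, cvg_prob P (f i) (g i)) ->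
  exists2 phi : nat -> nat, forall k, (k <= phi k)%N &
    forall i, {ae P, forall w, f i (phi k) w @[k --> \oo] --> g i w}.
Proof.
move=> mfg fg.
pose E i k e := [set w | e < `|f i k w - g i w|].
have mE i k e : measurable (E i k e).
  by apply: mset_lt => //; exact: measurable_cst.
(* The index chosen for [k] has error above 1/(k+1) with probability at most 2^-(k+1): a summable
   bound, with errors tending to 0. *)
have /choice[phi phiP] : forall k, exists m, (k <= m)%N /\
    forall i, (P (E i m k.+1%:R^-1%R) <= (1 / (2 ^ k.+1)%:R)%:E)%E.
  move=> k; have e0 : 0 < 1 / (2 ^ k.+1)%:R :> R.
    by rewrite div1r invr_gt0 ltr0n expn_gt0.
  have hE : forall i, \forall m \near \oo,
      (P (E i m k.+1%:R^-1%R) <= (1 / (2 ^ k.+1)%:R)%:E)%E.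
    move=> i.
    have k0 : 0 < k.+1%:R^-1 :> R by rewrite invr_gt0.
    have /fine_cvgP[Efin] := fg i _ k0.
    move=> /cvgrPdist_le/(_ _ e0); apply: filterS2 Efin => m Em.
    rewrite sub0r normrN => Ee; rewrite -(fineK Em) lee_fin.
    exact: le_trans (ler_norm _) Ee.
  have hA : \forall m \near \oo, forall i,
      (P (E i m k.+1%:R^-1%R) <= (1 / (2 ^ k.+1)%:R)%:E)%E by apply: filter_forall.
  have [m _ mE'] := filterI (nbhs_infty_ge k) hA.
  by exists m; exact: (mE' m (leqnn m)).
exists phi; first by move=> k; have [] := phiP k.
move=> i; have := @borel_cantelli_ae (fun k => E i (phi k) k.+1%:R^-1) (fun k => mE _ _ _)
  (fun k => (phiP k).2 i).
apply: filterS => w [m mE']; apply/cvgrPdist_le => e e0.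
have [k0 _ k0e] := near_infty_natSinv_lt (PosNum e0).
exists (maxn m k0) => // k /=; rewrite geq_max => /andP[mk k0k].
rewrite distrC (le_trans _ (ltW (k0e k k0k)))// leNgt; exact/negP/mE'.
Qed.

(** Otherwise patching could go on forever, each time lowering the current function by at least 1 on
    an event of probability above [delta]. The limit superior of these events would keep mass at
    least [delta]; yet it is empty, since a nonnegative function can be lowered by 1 only finitely
    often at each point. *)
Lemma near_minimal (H : set (Omega -> R)) (delta : R) : 0 < delta ->
  H !=set0 -> (forall h, H h -> measurable_fun setT h /\ forall w, 0 <= h w) ->
  (forall h h', H h -> H h' ->
    H (fun w => if h' w + 1 <= h w then h' w else h w)) ->
  exists2 h, H h & forall h', H h' -> (P [set w | h' w + 1 <= h w]%R <= delta%:E)%E.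
Proof.
move=> delta0 [h0 Hh0] Hm Hp; apply: contrapT => nH.
have /choice[nxt nxtP] : forall h, exists h', H h ->
    H h' /\ (delta%:E < P [set w | h' w + 1 <= h w]%R)%E.
  move=> h; have [Hh|] := pselect (H h); last by exists h.
  have [h' Hh'] : exists h', ~ (H h' -> (P [set w | h' w + 1 <= h w]%R <= delta%:E)%E).
    by apply/existsNP => hH; apply: nH; exists h.
  by exists h' => _; move/not_implyP : Hh' => [? /negP]; rewrite -ltNge.
pose step h w := if nxt h w + 1 <= h w then nxt h w else h w.
pose u k := iter k step h0.
have Hu k : H (u k).
  by elim: k => // k IH; apply: Hp => //; have [] := nxtP _ IH.
pose D k := [set w | nxt (u k) w + 1 <= u k w].
have mD k : measurable (D k).
  have [Hn _] := nxtP _ (Hu k); apply: mset_le; last by have [] := Hm _ (Hu k).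
  apply: measurable_funD; last exact: measurable_cst.
  by have [] := Hm _ Hn.
have u_dec k w : u k.+1 w <= u k w.
  by rewrite /= /step; case: ifP => // ?; lra.
have u_mono k m w : (k <= m)%N -> u m w <= u k w.
  elim: m => [|m IH]; first by rewrite leqn0 => /eqP ->.
  rewrite leq_eqVlt => /predU1P[->//|/IH]; exact: le_trans.
have D0 : lim_sup_set D = set0.
  apply/seteqP; split=> // w Dw.
  suff /(_ (Num.truncn (h0 w)).+1)[k] : forall m, exists k, u k w <= h0 w - m%:R.
    have [_ /(_ w) u0] := Hm _ (Hu k).
    have := truncnS_gt (h0 w); lra.
  elim=> [|m [k km]]; first by exists 0%N; rewrite subr0.
  have [j /= kj Dj] := Dw k I; exists j.+1.
  rewrite /= /step Dj; have := u_mono _ _ w kj; rewrite -natr1.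
  move: Dj; rewrite /D /= => Dj; lra.
have : (delta%:E <= P (lim_sup_set D))%E.
  have Dcvg := lim_sup_set_cvg P D mD.
  have mU m : measurable (\bigcup_(k >= m) D k).
    by apply: bigcup_measurable => k _; exact: mD.
  have /Dcvg Dl : (P (\bigcup_(k >= 0) D k) < +oo)%E.
    exact: le_lt_trans (probability_le1 P (mU 0%N)) (ltry _).
  rewrite -(cvg_lim _ Dl)//; apply: lime_ge; first by apply/cvg_ex; eexists; exact: Dl.
  apply: nearW => m; have [_ /ltW/le_trans] := nxtP _ (Hu m); apply.
  by apply: le_measure; rewrite ?inE//; [exact: mD|move=> w Dw; exists m => /=].
by rewrite D0 measure0 lee_fin leNgt delta0.
Qed.

End convergence_in_probability.

(** * Strategies *)

Lemma measurable_truncn d (T : measurableType d) (R : realType) (f : T -> R) j :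
  measurable_fun setT f -> measurable [set w | Num.truncn (f w) = j].
Proof.
move=> mf; have mle i : measurable [set w | (Num.truncn (f w) <= i)%N].
  rewrite (_ : [set w | _] = [set w | f w < i.+1%:R]).
    by apply: mset_lt => //; exact: measurable_cst.
  by apply/seteqP; split=> w /=; rewrite truncn_le_nat.
case: j => [|j].
  by rewrite (_ : [set w | _] = [set w | (Num.truncn (f w) <= 0)%N])//;
    apply/seteqP; split=> w /=; rewrite leqn0 => /eqP.
rewrite (_ : [set w | _] = [set w | (Num.truncn (f w) <= j.+1)%N /\
    ~ (Num.truncn (f w) <= j)%N]).
  by apply: mset_and => //; exact: mset_not.
apply/seteqP; split=> w /=; first by move=> ->; rewrite leqnn ltnn.
by case=> wj /negP; rewrite -ltnNge => jw; apply/eqP; rewrite eqn_leq wj.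
Qed.

Section market.
Context {disp : measure_display} {Omega : measurableType disp} {R : realType}.
Variables (P : probability Omega R) (T : nat) (F : nat -> set (set Omega)).
Hypothesis hF : filtered_space P T F.

Lemma ae_forall_leq (n : nat) (Q : nat -> Omega -> Prop) :
  (forall t, (t <= n)%N -> {ae P, forall w, Q t w}) ->
  {ae P, forall w, forall t, (t <= n)%N -> Q t w}.
Proof.
move=> hQ; apply: ae_foralln => t; have [tn|tn] := leqP t n.
  by apply: filterS (hQ _ tn) => w.
by apply: aeW.
Qed.

Lemma filtration_mono s t : (s <= t)%N -> (t <= T)%N -> F s `<=` F t.
Proof. by move=> st tT; have [_ + _ _] := hF; apply; rewrite st. Qed.

Lemma filtration_measurable t : (t <= T)%N ->
  (F t).-sigma.-measurable `<=` @measurable _ Omega.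
Proof.
move=> tT A; have [sF _ FT _] := hF.
by rewrite (measurable_g_measurableTypeE (sF t tT))
  => /(filtration_mono tT (leqnn T)); rewrite FT.
Qed.

Lemma filtration_measurable_fun t (f : Omega -> R) : (t <= T)%N ->
  measurable_fun [set: g_sigma_algebraType (F t)] f -> measurable_fun [set: Omega] f.
Proof.
by move=> tT mf _ B mB; apply: (filtration_measurable tT); exact: mf.
Qed.

Lemma rvar_filtration s t n (f : Omega -> 'rV[R]_n) :
  (s <= t)%N -> (t <= T)%N -> rvar (F s) f -> rvar (F t) f.
Proof. by move=> st tT; apply: rvar_mono; exact: filtration_mono. Qed.

Section positions.
Context {d N : nat}.
Implicit Types (K : cone_process Omega R d N) (Rp : production_process Omega R d N).
Implicit Types (xi : nat -> Omega -> 'rV[R]_(d + N)) (x : Omega -> 'rV[R]_(d + N)).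

Lemma cone_class_regular K : cone_class P T F K ->
  {ae P, forall w, forall t, (t <= T)%N ->
    [/\ convex_cone (K t w), closed (K t w) & nneg `\ 0 `<=` (K t w)^°]}.
Proof.
move=> [X [mX KX]]; apply: ae_forall_leq => t tT; apply: filterS (KX t tT).
move=> w [/finite_support_bounded[m Xm] _ KE nK]; split=> //.
  by rewrite KE; exact: cone_hull_convex.
by rewrite KE (cone_hull_finite Xm); exact: fcone_closed.
Qed.

Lemma cone_class_measurable K t (y : Omega -> 'rV[R]_(d + N)) :
  cone_class P T F K -> (t <= T)%N -> rvar (F t) y ->
  exists2 A : set Omega, (F t).-sigma.-measurable A &
    {ae P, forall w : Omega, A w <-> K t w (y w)}.
Proof.
move=> [X [mX KX]] tT my.
have [|A mA AX] := @measurable_cone_hull _ _ _ (F t) _ (fun n => X n t) y _ my.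
  by move=> n; have [] := mX n t tT.
by exists A => //; apply: filterS (KX t tT) => w [fX _ -> _]; exact: AX.
Qed.

(** Rounded down to a grid, [al] takes countably many deterministic values, where returns are
    measurable; continuity passes to the limit. The grid lies in the orthant, outside which [Rp] is
    junk. Dates [r] beyond [t] serve claims that become known only later. *)
Lemma returns_measurable Rp r t (al : Omega -> 'rV[R]_N) :
  production_class T F Rp -> R1 P T Rp -> (t <= r)%N -> (r <= T)%N ->
  rvar (F r) al -> {ae P, forall w, nneg (al w)} ->
  exists2 f, rvar (F r) f & {ae P, forall w, f w = Rp t w (al w)}.
Proof.
move=> hR hR1 tr rT mal al0; have tT := leq_trans tr rT.
pose V n w : 'rV[nat]_N := \row_j Num.truncn (al w ord0 j * n.+1%:R).
pose a n (v : 'rV[nat]_N) : 'rV[R]_N := map_mx (fun i => i%:R / n.+1%:R) v.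
have a0 n v : nneg (a n v) by move=> j; rewrite mxE divr_ge0.
have mf n : rvar (F r) (fun w => Rp t w (a n (V n w))).
  apply: (@rvar_glue _ _ _ (F r) _ _ (V n) (fun v w => Rp t w (a n v))).
    move=> v; rewrite (_ : [set w | _] = [set w | forall j, V n w ord0 j = v ord0 j]).
      apply: (@mset_forall _ (g_sigma_algebraType (F r))) => j.
      rewrite (_ : [set w | _] = [set w | Num.truncn (al w ord0 j * n.+1%:R) = v ord0 j]).
        apply: (@measurable_truncn _ (g_sigma_algebraType (F r))).
        by apply: measurable_funM; [exact: mal|exact: measurable_cst].
      by apply/seteqP; split=> w /=; rewrite mxE.
    by apply/seteqP; split=> w /=; [move=> ->|move=> vj; exact/rowP].
  move=> v; apply: (rvar_filtration tr rT); have [_] := hR t tT; exact.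
have [f mf' fl] := rvar_lim mf; exists f => //.
apply: filterS2 al0 (hR1 t tT) => w al0 [_ Rc]; apply: fl.
apply: (within_cvg Rc) => //.
apply: cvg_row => j; apply/cvgrPdist_le => e e0.
have [k _ ke] := near_infty_natSinv_lt (PosNum e0); exists k => // m km.
rewrite (le_trans _ (ltW (ke m km)))// !mxE.
have am : 0 <= al w ord0 j * m.+1%:R by rewrite mulr_ge0.
have /andP[t1 t2] := truncn_itv am.
have m0 : 0 < m.+1%:R :> R by [].
have alE : al w ord0 j = al w ord0 j * m.+1%:R / m.+1%:R by rewrite mulfK// gt_eqF.
rewrite [X in `|X - _|]alE.
rewrite -mulrBl normrM (ger0_norm (_ : 0 <= _^-1)) ?invr_ge0// ler_piMl ?invr_ge0//.
by rewrite ger0_norm ?subr_ge0// lerBlDr addrC natr1 ltW.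
Qed.

Lemma claimS xi t w : claim xi t.+1 w = claim xi t w + rsubmx (xi t.+1 w).
Proof. by rewrite /claim big_ord_recr. Qed.

Lemma claim0 xi w : claim xi 0 w = rsubmx (xi 0%N w).
Proof. by rewrite /claim big_ord_recr /= big_ord0 add0r. Qed.

Lemma eq_claim xi xi' t w : (forall u, (u <= t)%N -> xi u w = xi' u w) ->
  claim xi t w = claim xi' t w.
Proof. by move=> e; apply: eq_bigr => i _; rewrite e// -ltnS. Qed.

Lemma eq_terminal (x : 'rV[R]_(d + N)) Rp xi xi' w :
  (forall u, (u <= T)%N -> xi u w = xi' u w) ->
  terminal T x Rp xi w = terminal T x Rp xi' w.
Proof.
move=> e; rewrite /terminal; congr (_ + _ + _).
  by apply: eq_bigr => i _; rewrite e// -ltnS.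
apply: eq_bigr => i _; rewrite (@eq_claim _ xi') // => u ui; apply: e.
by rewrite (leq_trans ui)// ltnW.
Qed.

(** Stated path by path, with a random initial position, so that it makes sense after division by a
    random factor and along random subsequences. *)
Definition admissible K x xi w : Prop := forall t, (t <= T)%N ->
  K t w (- xi t w) /\ nneg (claim xi t w + rsubmx (x w)).

Lemma eq_admissible K x xi xi' w : (forall u, (u <= T)%N -> xi u w = xi' u w) ->
  admissible K x xi w -> admissible K x xi' w.
Proof.
move=> e axi t tT; have [] := axi t tT; rewrite e// (@eq_claim _ xi')// => u ut.
exact/e/(leq_trans ut).
Qed.

(** The guard makes the condition empty at [s = T.+1], where the induction starts and [F s] is
    unconstrained. *)
Definition adapted_from s xi : Prop :=
  (s <= T)%N -> forall u, (u <= T)%N -> rvar (F (maxn s u)) (xi u).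

Lemma adapted_fromS s xi : adapted_from s xi -> adapted_from s.+1 xi.
Proof.
move=> mxi sT u uT; apply: rvar_filtration (mxi (ltnW sT) u uT).
  by rewrite geq_max leq_maxr (leq_trans (leqnSn s))// leq_maxl.
by rewrite geq_max sT.
Qed.

Lemma rvar_claim r xi t : (forall u, (u <= t)%N -> rvar (F r) (xi u)) ->
  rvar (F r) (claim xi t).
Proof.
move=> mxi; apply: rvar_sum => i; apply: rvar_rsubmx; apply: mxi.
by rewrite -ltnS.
Qed.

(** * Scaling strategies under concave production *)

Section scaling.
Variables (K : cone_process Omega R d N) (Rp : production_process Omega R d N).
Hypotheses (hK : cone_class P T F K) (hR : production_class T F Rp).
Hypotheses (hR1 : R1 P T Rp) (hR2 : R2 P T F K Rp).

(* By concavity, the returns of the claims scaled by [th] exceed the scaled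
   returns by [slack], which lies in the solvency cone. *)
Definition slack (th : R) (x : 'rV[R]_(d + N)) xi t w :=
  if t is u.+1 then
    Rp t w (th *: (rsubmx x + claim xi u w)) - th *: Rp t w (rsubmx x + claim xi u w)
  else 0.

(** Throwing the slack away makes the terminal value scale exactly; being financial, the slack
    leaves the claims alone. *)
Definition rescaled (th : R) (x : 'rV[R]_(d + N)) xi t w :=
  th *: xi t w - slack th x xi t w.

Section pathwise.
Variables (th : R) (x : Omega -> 'rV[R]_(d + N)) (xi : nat -> Omega -> 'rV[R]_(d + N)).
Variable w : Omega.
Hypotheses (th0 : 0 <= th) (axi : admissible K x xi w).

Lemma slack_financial t : (t <= T)%N -> rsubmx (slack th (x w) xi t w) = 0.
Proof.
case: t => [|t] tT; first by rewrite linear0.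
have [RF _] := hR tT; have [_ al0] := axi (ltnW tT).
rewrite addrC in al0.
rewrite /slack linearB linearZ /= !RF ?scaler0 ?subr0// => j.
by rewrite mxE mulr_ge0.
Qed.

Lemma claim_rescaled t : (t <= T)%N ->
  claim (rescaled th (x w) xi) t w = th *: claim xi t w.
Proof.
move=> tT; rewrite /claim scaler_sumr; apply: eq_bigr => i _.
rewrite /rescaled linearB linearZ /= slack_financial ?subr0//.
by rewrite (leq_trans _ tT)// -ltnS.
Qed.

Lemma terminal_rescaled :
  terminal T (th *: x w) Rp (rescaled th (x w) xi) w = th *: terminal T (x w) Rp xi w.
Proof.
have sE : \sum_(t < T.+1) rescaled th (x w) xi t w =
    th *: (\sum_(t < T.+1) xi t w) - \sum_(t < T.+1) slack th (x w) xi t w.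
  by rewrite scaler_sumr -sumrB.
rewrite /terminal sE !scalerDr -!addrA; congr (_ + (_ + _)).
(* The slack is 0 at date 0, so its sum is indexed like the returns and cancels their excess term by
   term. *)
rewrite big_ord_recl /= add0r addrC -sumrB scaler_sumr.
apply: eq_bigr => i _; rewrite claim_rescaled; last exact: ltnW.
by rewrite linearZ /= -scalerDr /bump leq0n add1n add0n opprB addrCA subrr addr0.
Qed.

Lemma admissible_rescaled :
  (forall t, (t <= T)%N -> convex_cone (K t w)) ->
  (forall t, (t <= T)%N -> K t w (slack th (x w) xi t w)) ->
  admissible K (fun w => th *: x w) (rescaled th (x w) xi) w.
Proof.
move=> cK Ks t tT; have [Kxi al0] := axi tT; split.
  have [_ KD KZ] := cK t tT.
  by rewrite /rescaled opprB addrC -scalerN; apply: KD; [exact: KZ|exact: Ks].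
rewrite claim_rescaled// linearZ /= -scalerDr => j.
by rewrite mxE mulr_ge0.
Qed.

End pathwise.

Lemma rescaling s (m : Omega -> nat) x xi : (s <= T)%N ->
  adapted_from s xi -> rvar (F s) x -> {ae P, forall w, admissible K x xi w} ->
  (forall j, (F s).-sigma.-measurable [set w | m w = j]) ->
  exists xi', [/\ adapted_from s xi',
    {ae P, forall w, forall t, (t <= T)%N ->
      xi' t w = rescaled (m w)%:R^-1 (x w) xi t w},
    {ae P, forall w, admissible K (fun w => (m w)%:R^-1 *: x w) xi' w} &
    {ae P, forall w, terminal T ((m w)%:R^-1 *: x w) Rp xi' w =
                     (m w)%:R^-1 *: terminal T (x w) Rp xi w}].
Proof.
move=> sT mxi mx axi mm; pose th w : R := (m w)%:R^-1.
have mth r : (s <= r)%N -> (r <= T)%N -> measurable_fun [set: g_sigma_algebraType (F r)] th.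
  move=> sr rT; apply: (gmfun_mono (filtration_mono sr rT)).
  apply: (@measurable_fun_glue _ (g_sigma_algebraType (F s)) R nat m
    (fun j _ => j%:R^-1)) => //.
have mal u r : (maxn s u <= r)%N -> (r <= T)%N ->
    rvar (F r) (fun w => rsubmx (x w) + claim xi u w).
  rewrite geq_max => /andP[sr ur] rT; apply: rvarD.
    by apply: rvar_rsubmx; exact: rvar_filtration mx.
  apply: rvar_claim => v vu; apply: rvar_filtration (mxi sT v _) => //.
    by rewrite geq_max sr (leq_trans vu).
  by rewrite (leq_trans vu)// (leq_trans ur).
have al0 u : (u <= T)%N -> {ae P, forall w, nneg (rsubmx (x w) + claim xi u w)}.
  by move=> uT; apply: filterS axi => w /(_ u uT)[_]; rewrite addrC.
have thal0 u : (u <= T)%N -> {ae P, forall w, nneg (th w *: (rsubmx (x w) + claim xi u w))}.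
  by move=> uT; apply: filterS (al0 u uT) => w al j; rewrite mxE mulr_ge0// /th invr_ge0.
(* Returns of random claims are measurable only up to null sets, so measurable versions of the
   rescaled components are chosen. *)
have /choice[f fP] : forall t, exists f, (t <= T)%N ->
    rvar (F (maxn s t)) f /\
    {ae P, forall w, f w = rescaled (th w) (x w) xi t w}.
  case=> [|u].
    exists (fun w => th w *: xi 0%N w) => _; split.
      by apply: rvarZ; [apply: mth; rewrite ?maxn0|exact: mxi].
    by apply: aeW => w; rewrite /rescaled subr0.
  have [uT|] := leqP u.+1 T; last by exists 0.
  set r := maxn s u.+1.
  have rT : (r <= T)%N by rewrite geq_max sT.
  have sr : (s <= r)%N by rewrite leq_maxl.
  have ur : (u.+1 <= r)%N by rewrite leq_maxr.
  have sur : (maxn s u <= r)%N by rewrite geq_max sr ltnW.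
  have [f1 mf1 f1E] := returns_measurable hR hR1 ur rT (mal u r sur rT) (al0 u (ltnW uT)).
  have [f2 mf2 f2E] := returns_measurable hR hR1 ur rT
    (rvarZ (mth r sr rT) (mal u r sur rT)) (thal0 u (ltnW uT)).
  exists (fun w => th w *: xi u.+1 w - (f2 w - th w *: f1 w)) => _; split.
    apply: rvarB; first by apply: rvarZ; [exact: mth|exact: mxi].
    by apply: rvarB => //; apply: rvarZ => //; exact: mth.
  by apply: filterS2 f1E f2E => w -> ->.
exists f.
have fE : {ae P, forall w, forall t, (t <= T)%N -> f t w = rescaled (th w) (x w) xi t w}.
  by apply: ae_forall_leq => t tT; have [] := fP t tT.
have Ks : {ae P, forall w, forall t, (t <= T)%N -> K t w (slack (th w) (x w) xi t w)}.
  apply: ae_forall_leq => -[|u] tT.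
    by apply: filterS (cone_class_regular hK) => w /(_ 0%N tT)[[]].
  have hal : L0 P (fun=> nneg) (F T) (fun w => rsubmx (x w) + claim xi u w).
    split; last exact: al0 (ltnW tT).
    by apply: mal => //; rewrite geq_max sT ltnW.
  have h0 : L0 P (fun=> nneg) (F T) (fun=> 0 : 'rV[R]_N).
    by split; [exact: rvar_cst|apply: aeW => w j; rewrite mxE].
  (* Concavity is used between the claim and 0, whose return is 0, at all weights 1/j
     simultaneously; the value 1/0 = 0 is a legitimate weight too. *)
  have j01 (j : nat) : 0 <= (j%:R^-1 : R) <= 1.
    rewrite invr_ge0 ler0n /=.
    by case: j => [|j]; rewrite ?invr0 ?ler01// invf_le1// ler1n.
  have := ae_foralln (fun j : nat => hR2 tT (j01 j) hal h0).
  apply: filterS2 (hR1 tT) => w [R0 _] /(_ (m w))[].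
  by rewrite R0 !scaler0 !addr0 opprB.
split.
- by move=> _ u uT; have [] := fP u uT.
- exact: fE.
- apply: filterS3 (filterI fE axi) Ks (cone_class_regular hK) => w [fEw aw] Ksw Kr.
  apply: eq_admissible (fun u uT => esym (fEw u uT)) _.
  apply: (@admissible_rescaled (th w) x) => //; first by rewrite /th invr_ge0.
  by move=> t tT; have [] := Kr t tT.
- apply: filterS2 fE axi => w fEw aw.
  by rewrite (eq_terminal _ _ fEw); apply: terminal_rescaled => //; rewrite invr_ge0.
Qed.

(** The slack at date t involves claims up to t-1 only, so convergence strictly before [s] controls
    it up to and including [s]. The scaled claims tend to 0, where [Rp] is continuous with value 0,
    and the unscaled returns converge while their factor tends to 0. *)
Lemma slack_cvg0 (th : nat -> R) (x : nat -> Omega -> 'rV[R]_(d + N))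
    (l : 'rV[R]_(d + N)) (xi : nat -> nat -> Omega -> 'rV[R]_(d + N))
    (xioo : nat -> Omega -> 'rV[R]_(d + N)) s t w :
  (t <= s)%N -> (t <= T)%N -> {within nneg, continuous (Rp t w)} -> Rp t w 0 = 0 ->
  (forall k, admissible K (x k) (xi k) w) -> (forall k, 0 <= th k) ->
  th @ \oo --> 0 -> (fun k => x k w) @ \oo --> l ->
  (forall u, (u < s)%N -> (fun k => xi k u w) @ \oo --> xioo u w) ->
  (fun k => slack (th k) (x k w) (xi k) t w) @ \oo --> (0 : 'rV[R]_(d + N)).
Proof.
case: t => [|u] us uT Rc R0 axi th0 thl xl xil; first exact: cvg_cst.
pose al k := rsubmx (x k w) + claim (xi k) u w.
have al0 k : nneg (al k) by rewrite /al addrC; have [] := axi k u (ltnW uT).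
have alc : al k @[k --> \oo] --> rsubmx l + claim xioo u w.
  apply: cvgD; first exact: rsubmx_cvg.
  apply: cvg_seq_sum => i; apply: rsubmx_cvg; apply: xil.
  exact: leq_trans us.
have -> : (0 : 'rV[R]_(d + N)) =
    Rp u.+1 w 0 - 0 *: Rp u.+1 w (rsubmx l + claim xioo u w).
  by rewrite R0 scale0r subr0.
apply: cvgB.
  apply: (within_cvg Rc) => [k j|j|].
  - by rewrite mxE mulr_ge0//; exact: al0.
  - by rewrite mxE.
  - by rewrite -(scale0r (rsubmx l + claim xioo u w)); exact: cvgZ.
apply: cvgZ => //; apply: (within_cvg Rc) => //; exact: nneg_closed alc.
Qed.

Lemma limit_strategy (x : nat -> Omega -> 'rV[R]_(d + N)) (xoo : Omega -> 'rV[R]_(d + N))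
    (xi : nat -> nat -> Omega -> 'rV[R]_(d + N))
    (xioo : nat -> Omega -> 'rV[R]_(d + N)) w (g : 'rV[R]_(d + N)) :
  (forall t, (t <= T)%N -> closed (K t w)) ->
  (forall t, (t <= T)%N -> {within nneg, continuous (Rp t w)}) ->
  (forall k, admissible K (x k) (xi k) w) ->
  (fun k => x k w) @ \oo --> xoo w ->
  (forall u, (u <= T)%N -> (fun k => xi k u w) @ \oo --> xioo u w) ->
  (fun k => terminal T (x k w) Rp (xi k) w) @ \oo --> g ->
  admissible K xoo xioo w /\ terminal T (xoo w) Rp xioo w = g.
Proof.
move=> Kc Rc axi xl xil gl.
have clc t : (t <= T)%N -> claim (xi k) t w @[k --> \oo] --> claim xioo t w.
  move=> tT; apply: cvg_seq_sum => i; apply: rsubmx_cvg; apply: xil.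
  by rewrite (leq_trans _ tT)// -ltnS.
have adm : admissible K xoo xioo w.
  move=> t tT; split.
    apply: (@closed_cvg nat _ \oo _ (fun k => - xi k t w) (K t w) (Kc t tT)
      _ _ (cvgN (xil t tT))).
    by apply: nearW => k; have [] := axi k t tT.
  apply: (nneg_closed (u := fun k => claim (xi k) t w + rsubmx (x k w))).
    by move=> k; have [] := axi k t tT.
  by apply: cvgD; [exact: clc|exact: rsubmx_cvg].
split=> //; apply: (cvg_unique _ _ gl) => //.
apply: cvgD; first apply: cvgD => //.
  by apply: cvg_seq_sum => i; apply: xil; rewrite -ltnS.
apply: cvg_seq_sum => i; apply: (within_cvg (Rc i.+1 _)) => //.
- by move=> k; rewrite addrC; have [] := axi k i (ltnW (ltn_ord i)).
- by rewrite addrC; have [] := adm i (ltnW (ltn_ord i)).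
- by apply: cvgD; [exact: rsubmx_cvg|exact/clc/ltnW].
Qed.

End scaling.

(** * Strategies with zero terminal value *)

Section null_strategies.
Variables (K : cone_process Omega R d N) (Rp : production_process Omega R d N).
Hypotheses (hd : (1 <= d)%N) (hR : production_class T F Rp).
Hypotheses (hK : cone_class P T F K) (hR1 : R1 P T Rp) (hNA : NAr P T F K Rp).

(** The profit to be extracted: nonnegative and nonzero as d >= 1, hence interior to the solvency
    cones, and financial, so that claims do not change. *)
Definition e_fin : 'rV[R]_(d + N) := row_mx (const_mx 1) 0.

Lemma e_fin_nneg : nneg e_fin.
Proof.
move=> j; case: (fintype.split_ordP j) => i ->; first by rewrite row_mxEl mxE.
by rewrite row_mxEr mxE.
Qed.

Lemma e_fin_neq0 : e_fin != 0.
Proof.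
apply/eqP => /rowP/(_ (lshift N (Ordinal hd))).
by rewrite row_mxEl !mxE => /eqP; rewrite oner_eq0.
Qed.

Lemma rsubmx_e_fin : rsubmx e_fin = 0.
Proof. by rewrite row_mxKr. Qed.

(** Domination leaves room for profit in two ways: a nonzero claim invested puts the gain [del] in a
    relative interior by (D2), and a financial trade outside the lineality space is solvent with
    room to spare in [Kt] by (D1). Either way a small multiple of [e_fin] could be extracted,
    against [NA] for the dominating model. *)
Lemma null_strategy zeta : strategies P T F 0 K zeta ->
  {ae P, forall w, terminal T 0 Rp zeta w = 0} ->
  {ae P, forall w, \sum_(t < T.+1) zeta t w = 0 /\ forall t, (t <= T)%N ->
    [/\ K t w (zeta t w), K t w (- zeta t w) & rsubmx (zeta t w) = 0]}.
Proof.
move=> [mz az] tz; have [Kt [Rt [hKt hRt mRt [hD1 hD2] hNAt]]] := hNA.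
have mzeta t r : (t <= r)%N -> (r <= T)%N -> rvar (F r) (zeta t).
  by move=> tr rT; apply: (rvar_filtration tr rT); have [] := mz t (leq_trans tr rT).
have mcl t r : (t <= r)%N -> (r <= T)%N -> rvar (F r) (claim zeta t).
  by move=> tr rT; apply: rvar_claim => u ut; apply: mzeta => //; exact: leq_trans tr.
have az' : {ae P, forall w, admissible K (fun=> 0) zeta w} by exact: ae_forall_leq.
have cl0 t : (t <= T)%N -> {ae P, forall w, nneg (claim zeta t w)}.
  by move=> tT; apply: filterS (az t tT) => w [_]; rewrite linear0 addr0.
have /choice[del delP] : forall t, exists f, (t <= T)%N -> rvar (F t) f /\
    {ae P, forall w, f w = if t is u.+1 then
       Rt t w (claim zeta u w) - Rp t w (claim zeta u w) else 0}.
  case=> [|u]; first by exists (fun=> 0) => _; split; [exact: rvar_cst|exact: aeW].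
  have [uT|] := leqP u.+1 T; last by exists 0.
  have [f1 [mf1 _] f1E] := mRt u uT (claim zeta u)
    (conj (mcl u u (leqnn u) (ltnW uT)) (cl0 u (ltnW uT))).
  have [f2 mf2 f2E] := returns_measurable hR hR1 (leqnn u.+1) uT
    (mcl u u.+1 (leqnSn u) uT) (cl0 u (ltnW uT)).
  exists (fun w => f1 w - f2 w) => _; split; first exact: rvarB.
  by apply: filterS2 f1E f2E => w -> ->.
have delE : {ae P, forall w, forall t, (t <= T)%N -> del t w =
     if t is u.+1 then Rt t w (claim zeta u w) - Rp t w (claim zeta u w) else 0}.
  by apply: ae_forall_leq => t tT; have [] := delP t tT.
have Kr := cone_class_regular hK; have Ktr := cone_class_regular hKt.
have hD2' := ae_forall_leq hD2; have hD1' := ae_forall_leq hD1.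
have hR1' := ae_forall_leq hR1.
(* [del] is the gain of using [Rt] instead of [Rp]; throwing it away turns [zeta]
   into a strategy for the dominating model with the same terminal value. *)
have delK : {ae P, forall w, forall t, (t <= T)%N -> financial (K t w) (del t w)}.
  apply: filterS3 (filterI delE az') (filterI Kr hD2') hR1'.
  move=> w [dE aw] [Kw D2w] R1w t tT.
  rewrite dE//; have [[K0 _ _] _ _] := Kw t tT.
  case: t tT K0 dE => [|u] tT K0 dE; first by split=> //=; rewrite linear0.
  have [_] := aw u (ltnW tT); rewrite linear0 addr0 => al0.
  have [D20 D2al] := D2w u.+1 tT.
  have [->|al] := eqVneq (claim zeta u w) 0.
    by have [-> _] := R1w u.+1 tT; rewrite subr0.
  by have [] := D2al _ al0 al.
(* Wherever 1/(m+1) of [e_fin] can be extracted at [t0], extract it. That event is known at [t0],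
   and the payoff [h] is attainable and nonnegative, hence 0, so the event is null. *)
have noarb t0 m : (t0 <= T)%N ->
    {ae P, forall w, ~ Kt t0 w (- (zeta t0 w - del t0 w + m.+1%:R^-1 *: e_fin))}.
  move=> t0T.
  have mdel t : (t <= T)%N -> rvar (F t) (del t) by move=> /delP[].
  pose em : 'rV[R]_(d + N) := m.+1%:R^-1 *: e_fin.
  have [A mA AK] := cone_class_measurable hKt t0T
    (rvarN (rvarD (rvarB (mzeta t0 t0 (leqnn _) t0T) (mdel t0 t0T))
      (rvar_cst em))).
  pose h (w : Omega) : 'rV[R]_(d + N) := if `[< A w >] then m.+1%:R^-1 *: e_fin else 0.
  have hF' w : rsubmx (h w) = 0.
    by rewrite /h; case: ifP => _; rewrite ?linear0// linearZ /= rsubmx_e_fin scaler0.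
  have mh : rvar (F t0) h by apply: rvar_if mA _ _; exact: rvar_cst.
  pose zeta' t w := zeta t w - del t w + (if t == t0 then h w else 0).
  have sumh w : \sum_(t < T.+1) (if nat_of_ord t == t0 then h w else 0) = h w.
    have t0T' : (t0 < T.+1)%N by rewrite ltnS.
    rewrite (bigD1 (Ordinal t0T'))//= eqxx big1 ?addr0// => i.
    by rewrite -val_eqE /= => /negbTE ->.
  have clE : {ae P, forall w, forall t, (t <= T)%N -> claim zeta' t w = claim zeta t w}.
    apply: filterS delK => w dK t tT; apply: eq_bigr => i _.
    have [|_ /= dF] := dK i; first by rewrite (leq_trans _ tT)// -ltnS.
    rewrite /zeta' linearD linearB /= dF subr0.
    by case: ifP => _; rewrite ?hF' ?linear0 addr0.
  have hatt : attainable P T F 0 Kt Rt h.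
    split; first by split; [exact: rvar_filtration mh|exact: aeW].
    exists zeta'.
      split=> [t tT|t tT].
        split; last exact: aeW.
        apply: rvarD; first by apply: rvarB; [exact: mzeta|exact: mdel].
        by case: eqP => [->|_]; [exact: mh|exact: rvar_cst].
      apply: filterS3 (filterI AK delK) (filterI clE az') (filterI Ktr hD1').
      move=> w [Aw dK] [cE aw] [Kw D1w]; have [Kz al0] := aw t tT.
      rewrite cE//; split => //.
      have [_ KKt] := D1w t tT; have [[KD0 KD KZ] _ _] := Kw t tT.
      have Kzd : Kt t w (- zeta t w + del t w).
        by apply: KD; apply: KKt => //; have [] := dK t tT.
      rewrite /oppset /= /zeta' /h; case: eqP => [tt0|_]; last first.
        by rewrite addr0 opprB addrC.
      case: asboolP => [|_]; last by rewrite addr0 opprB addrC.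
      by rewrite {1}tt0; move: Aw; rewrite -tt0 => /[apply].
    apply: filterS3 (filterI delE clE) tz delK => w [dE cE] tw dK.
    have dS : \sum_(t < T.+1) del t w = \sum_(i < T) Rt i.+1 w (claim zeta i w)
        - \sum_(i < T) Rp i.+1 w (claim zeta i w).
      rewrite big_ord_recl dE// add0r -sumrB.
      by apply: eq_bigr => i _; exact: (dE i.+1 (ltn_ord i)).
    have zS : \sum_(t < T.+1) zeta' t w =
        \sum_(t < T.+1) zeta t w - \sum_(t < T.+1) del t w + h w.
      by rewrite /zeta' big_split /= sumh sumrB.
    have RE : \sum_(t < T) Rt t.+1 w (rsubmx (0 : 'rV[R]_(d + N)) + claim zeta' t w) =
        \sum_(t < T) Rt t.+1 w (claim zeta t w).
      by apply: eq_bigr => i _; rewrite linear0 add0r cE// ltnW.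
    move: tw; rewrite /terminal RE zS dS !add0r => tw.
    have {}tw : \sum_(t < T.+1) zeta t w + \sum_(t < T) Rp t.+1 w (claim zeta t w) = 0.
      rewrite -[RHS]tw; congr (_ + _).
      by apply: eq_bigr => i _; rewrite linear0 add0r.
    have cancel4 (a b c z : 'rV[R]_(d + N)) : a + c = 0 -> z = a - (b - c) + z + b.
      move=> /eqP; rewrite addr_eq0 => /eqP ->.
      by rewrite opprB addrA addNr sub0r addrAC addNr add0r.
    exact: cancel4.
  have : L0 P (fun=> [set 0]) (F T) h.
    rewrite -hNAt; split => //; split; first exact: rvar_filtration mh.
    apply: aeW => w; rewrite /h; case: ifP => _ j; last by rewrite mxE.
    by rewrite mxE mulr_ge0 ?invr_ge0//; exact: e_fin_nneg.
  case=> _; apply: filterS2 AK => w Aw /= hw0 /Aw Aw'.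
  move: hw0; rewrite /h asboolT// => /eqP.
  by rewrite scaler_eq0 invr_eq0 pnatr_eq0 /= (negbTE e_fin_neq0).
have noarb' : {ae P, forall w, forall t, (t <= T)%N -> forall m,
    ~ Kt t w (- (zeta t w - del t w + m.+1%:R^-1 *: e_fin))}.
  by apply: ae_forall_leq => t tT; apply: ae_foralln => m; exact: noarb.
apply: filterS3 (filterI (filterI delE delK) (filterI az' tz))
  (filterI (filterI Kr Ktr) (filterI hD1' hD2')) (filterI noarb' hR1').
move=> w [[dE dK] [aw tw]] [[Kw Ktw] [D1w D2w]] [noarbw R1w].
have e_int t : (t <= T)%N -> (K t w)^° e_fin.
  move=> tT; have [_ _] := Kw t tT; apply; split; first exact: e_fin_nneg.
  exact/eqP/e_fin_neq0.
have e_intt t : (t <= T)%N -> (Kt t w)^° e_fin.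
  move=> tT; have [_ _] := Ktw t tT; apply; split; first exact: e_fin_nneg.
  exact/eqP/e_fin_neq0.
have cl0' u : (u < T)%N -> claim zeta u w = 0.
  move=> uT; apply: contrapT => /eqP clu.
  have [_] := aw u (ltnW uT); rewrite linear0 addr0 => al0.
  have [_ /(_ _ al0 clu) drel] := D2w u.+1 uT.
  have [cK _ _] := Kw u.+1 uT; have [[_ KD _] _ _] := Ktw u.+1 uT.
  have [m Km] := relint_financial cK rsubmx_e_fin (e_int _ uT) drel.
  apply: (noarbw u.+1 uT m).
  have [_ KKt] := D1w u.+1 uT.
  rewrite !opprD opprK -addrA; apply: KD; apply: KKt; last by rewrite dE.
  by have [] := aw u.+1 uT.
have sum0 : \sum_(t < T.+1) zeta t w = 0.
  move: tw; rewrite /terminal add0r [X in _ + X]big1 ?addr0// => i _.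
  by rewrite linear0 add0r cl0'//; have [] := R1w i.+1 (ltn_ord i).
(* A claim held at [T] earns nothing, so (D2) is silent about it; it vanishes as the investment part
   of the zero sum of all trades. *)
have cl0'' t : (t <= T)%N -> claim zeta t w = 0.
  rewrite leq_eqVlt => /predU1P[->|]; last exact: cl0'.
  by rewrite /claim -linear_sum /= sum0 linear0.
have zF t : (t <= T)%N -> rsubmx (zeta t w) = 0.
  case: t => [|t] tT; first by rewrite -claim0 cl0''.
  by have := cl0'' _ tT; rewrite claimS cl0'' ?add0r// ltnW.
split=> // t tT; have [Kz _] := aw t tT; split=> //; last exact: zF.
(* (D1) speaks of financial positions only and applies now that [zeta t] is known to be one. *)
apply: contrapT => nKz; have [D1t KKt] := D1w t tT.
have [cKt _ _] := Ktw t tT; have [_ KD _] := cKt.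
have [|m Km] := relint_financial cKt rsubmx_e_fin (e_intt _ tT) (y := - zeta t w).
  apply: D1t; split; first by split=> //=; rewrite linearN /= zF ?oppr0.
  by case=> _ [/=]; rewrite opprK.
apply: (noarbw t tT m); rewrite !opprD opprK addrAC.
by apply: KD => //; apply: KKt; have [] := dK t tT.
Qed.

End null_strategies.

End positions.
End market.

(** * Closedness *)

Lemma cvg_along (V : topologicalType) (u : nat -> V) (tau : nat -> nat) (l : V) :
  (forall k, (k <= tau k)%N) -> u @ \oo --> l -> (fun k => u (tau k)) @ \oo --> l.
Proof.
move=> htau ul A /ul[m _ mA]; exists m => // k /= mk.
exact: mA (leq_trans mk (htau k)).
Qed.

Section closing.
Context {disp : measure_display} {Omega : measurableType disp} {R : realType}.
Variables (P : probability Omega R) (T : nat) (F : nat -> set (set Omega)).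
Hypothesis hF : filtered_space P T F.
Context {d N : nat}.
Variables (K : cone_process Omega R d N) (Rp : production_process Omega R d N).
Hypotheses (hd : (1 <= d)%N) (hK : cone_class P T F K) (hR : production_class T F Rp).
Hypotheses (hR1 : R1 P T Rp) (hR2 : R2 P T F K Rp) (hNA : NAr P T F K Rp).
Local Notation vect := 'rV[R]_(d + N).
Implicit Types (xi : nat -> Omega -> vect) (x : Omega -> vect).

(** Freezing the components before [s] preserves the convergence already secured for them. *)
Definition competitor s x xi0 xi : Prop :=
  [/\ adapted_from T F s xi, {ae P, forall w, admissible T K x xi w},
      {ae P, forall w, terminal T (x w) Rp xi w = terminal T (x w) Rp xi0 w} &
      forall r, (r < s)%N -> xi r = xi0 r].

Lemma near_minimal_competitor s x xi0 (delta : R) : (s <= T)%N -> 0 < delta ->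
  competitor s x xi0 xi0 -> exists2 xi, competitor s x xi0 xi &
    forall xi', competitor s x xi0 xi' ->
      (P [set w | `|xi' s w| + 1 <= `|xi s w|]%R <= delta%:E)%E.
Proof.
move=> sT delta0 c0.
pose H := [set h | exists2 xi, competitor s x xi0 xi & h = fun w => `|xi s w|].
have mnorm xi r : competitor s x xi0 xi -> (s <= r)%N -> (r <= T)%N ->
    measurable_fun [set: g_sigma_algebraType (F r)] (fun w : Omega => `|xi s w|).
  move=> [mxi _ _ _] sr rT; apply: rvar_norm; apply: (rvar_filtration hF sr rT).
  by have := mxi sT s sT; rewrite maxnn.
have [|||h [xi cxi ->] hmin] := near_minimal P (H := H) delta0.
- by exists (fun w => `|xi0 s w|); exists xi0.
- move=> h [xi cxi ->]; split=> //.
  by apply: (filtration_measurable_fun hF sT); exact: mnorm.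
- move=> h h' [xi cxi ->] [xi' cxi' ->].
  (* This event is known at [s], and [adapted_from] requires no earlier information, so switching on
     it yields a competitor again. *)
  pose A := [set w | `|xi' s w| + 1 <= `|xi s w|].
  pose xi'' u w := if `[< A w >] then xi' u w else xi u w.
  have AE w : `[< A w >] = (`|xi' s w| + 1 <= `|xi s w|) by exact: asboolb.
  exists xi''; last by apply/funext => w; rewrite /xi'' AE; case: ifP.
  have [mxi axi txi exi] := cxi; have [mxi' axi' txi' exi'] := cxi'; split.
  + move=> _ u uT; apply: rvar_if; [|exact: mxi'|exact: mxi].
    have sr : (s <= maxn s u)%N by rewrite leq_maxl.
    have rT : (maxn s u <= T)%N by rewrite geq_max sT.
    apply: (@mset_le _ (g_sigma_algebraType (F (maxn s u)))); last exact: mnorm.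
    by apply: measurable_funD; [exact: mnorm|exact: measurable_cst].
  + apply: filterS2 axi axi' => w aw aw'; have [Aw|Aw] := boolP `[< A w >].
      by apply: eq_admissible aw' => u _; rewrite /xi'' Aw.
    by apply: eq_admissible aw => u _; rewrite /xi'' (negbTE Aw).
  + apply: filterS2 txi txi' => w tw tw'; have [Aw|Aw] := boolP `[< A w >].
      by rewrite -tw'; apply: eq_terminal => u _; rewrite /xi'' Aw.
    by rewrite -tw; apply: eq_terminal => u _; rewrite /xi'' (negbTE Aw).
  + by move=> r rs; apply/funext => w; rewrite /xi'' exi// exi'//; case: ifP.
by exists xi => // xi' cxi'; apply: hmin; exists xi'.
Qed.

(* A random subsequence chosen measurably at date [s] is no longer adapted
   before [s]; therefore [adapted_from] only asks that the components before [s]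
   be known at [s]. *)
Definition closed_from s : Prop := forall (x : nat -> Omega -> vect)
    (xi : nat -> nat -> Omega -> vect) xoo xioo goo,
  (forall k, (s <= T)%N -> rvar (F s) (x k)) ->
  (forall k, adapted_from T F s (xi k)) ->
  {ae P, forall w, forall k, admissible T K (x k) (xi k) w} ->
  {ae P, forall w, (fun k => x k w) @ \oo --> (xoo w : vect)} ->
  {ae P, forall w, forall u, (u < s)%N ->
    (fun k => xi k u w) @ \oo --> (xioo u w : vect)} ->
  {ae P, forall w, (fun k => terminal T (x k w) Rp (xi k) w) @ \oo --> (goo w : vect)} ->
  exists xi', [/\ forall u, (u < s)%N -> xi' u = xioo u,
    forall u, (s <= u)%N -> (u <= T)%N -> rvar (F u) (xi' u) &
    {ae P, forall w, admissible T K xoo xi' w /\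
       terminal T (xoo w) Rp xi' w = goo w}].

Lemma closed_from_horizon : closed_from T.+1.
Proof.
move=> x xi xoo xioo goo _ _ axi xl xil gl; exists xioo; split=> //.
  by move=> u /leq_trans/[apply]; rewrite ltnn.
apply: filterS3 (filterI axi xl) (filterI xil gl)
  (filterI (cone_class_regular hK) (ae_forall_leq hR1)).
move=> w [aw xw] [xiw gw] [Kw Rw]; apply: limit_strategy aw xw _ gw => //.
- by move=> t tT; have [] := Kw t tT.
- by move=> t tT; have [] := Rw t tT.
Qed.

Lemma minimal_strategies_bounded s (x : nat -> Omega -> vect)
    (xi : nat -> nat -> Omega -> vect) xoo xioo (goo : Omega -> vect) :
  (s <= T)%N -> closed_from s.+1 ->
  (forall k, rvar (F s) (x k)) -> (forall k, adapted_from T F s (xi k)) ->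
  {ae P, forall w, forall k, admissible T K (x k) (xi k) w} ->
  {ae P, forall w, (fun k => x k w) @ \oo --> (xoo w : vect)} ->
  {ae P, forall w, forall u, (u < s)%N ->
    (fun k => xi k u w) @ \oo --> (xioo u w : vect)} ->
  {ae P, forall w, (fun k => terminal T (x k w) Rp (xi k) w) @ \oo --> (goo w : vect)} ->
  (forall k xi', competitor s (x k) (xi k) xi' ->
    (P [set w | `|xi' s w| + 1 <= `|xi k s w|]%R <= (1 / (2 ^ k.+1)%:R)%:E)%E) ->
  {ae P, forall w, exists M, inf_many [set k | `|xi k s w| <= M]}.
Proof.
move=> sT IH mx mxi axi xl xil gl xi_min.
have mxis k : rvar (F s) (xi k s) by have := mxi k sT s sT; rewrite maxnn.
(* The event that the norms at [s] tend to infinity. *)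
pose B := [set w | forall M : nat, exists m, forall k : nat, (m <= k)%N -> M%:R < `|xi k s w|].
pose T' := g_sigma_algebraType (F s).
have mB : (F s).-sigma.-measurable B.
  apply: (@mset_forall _ T') => M; apply: (@mset_exists _ T') => m.
  apply: (@mset_forall _ T') => k; have [mk|mk] := leqP m k.
    rewrite (_ : [set w | _] = [set w | M%:R < `|xi k s w|]).
      by apply: (@mset_lt _ T'); [exact: measurable_cst|exact: rvar_norm].
    by apply/seteqP; split=> w /=; [apply|].
  rewrite (_ : [set w | _] = setT); first exact: (@measurableT _ T').
  by apply/seteqP; split.
(* Off [B] the scaling factor [m^-1] is [0^-1 = 0], hence the rescaled strategy vanishes. *)
pose m k w := if `[< B w >] then (Num.truncn `|xi k s w|).+1 else 0%N.
have mm k j : (F s).-sigma.-measurable [set w | m k w = j].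
  rewrite (_ : [set w | _] = [set w | (B w /\ (Num.truncn `|xi k s w|).+1 = j)] `|`
     [set w | ~ B w /\ 0%N = j]).
    apply: (@measurableU _ T'); apply: (@mset_and _ T') => //.
    - case: j => [|j].
        rewrite (_ : [set w | _] = set0); first exact: (@measurable0 _ T').
        by apply/seteqP; split.
      rewrite (_ : [set w | _] = [set w | Num.truncn `|xi k s w| = j]).
        by apply: (@measurable_truncn _ T'); exact: rvar_norm.
      by apply/seteqP; split=> w /=; [case|move=> ->].
    - exact: (@mset_not _ T').
    - exact: (@mset_const _ T').
  apply/seteqP; split=> w /=; rewrite /m.
    by case: asboolP => Bw; [left|right].
  by case: asboolP => Bw [] [].
have /choice[xi' xiP] : forall k, exists xi', [/\ adapted_from T F s xi',
    {ae P, forall w, forall t, (t <= T)%N ->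
      xi' t w = rescaled Rp (m k w)%:R^-1 (x k w) (xi k) t w},
    {ae P, forall w, admissible T K (fun w => (m k w)%:R^-1 *: x k w) xi' w} &
    {ae P, forall w, terminal T ((m k w)%:R^-1 *: x k w) Rp xi' w =
                     (m k w)%:R^-1 *: terminal T (x k w) Rp (xi k) w}].
  move=> k; apply: (rescaling hF hK hR hR1 hR2) => //.
  by apply: filterS axi => w.
have mxi' k : rvar (F s) (xi' k s).
  by have [mk _ _ _] := xiP k; have := mk sT s sT; rewrite maxnn.
have thE : {ae P, forall w, forall k t, (t <= T)%N ->
    xi' k t w = rescaled Rp (m k w)%:R^-1 (x k w) (xi k) t w}.
  by apply: ae_foralln => k; have [] := xiP k.
have th_cvg w : (fun k => (m k w)%:R^-1 : R) @ \oo --> 0.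
  have [Bw|Bw] := pselect (B w); last first.
    by under eq_fun do rewrite /m asboolF// invr0; exact: cvg_cst.
  apply/cvgrPdist_le => e e0.
  have [j _ je] := near_infty_natSinv_lt (PosNum e0).
  have [k0 k0j] := Bw j.+1; exists k0 => // k /= kk.
  rewrite sub0r normrN ger0_norm ?invr_ge0// /m asboolT//.
  rewrite (le_trans _ (ltW (je j (leqnn j))))// lef_pV2 ?posrE//.
  by rewrite ltW// (lt_trans (k0j k kk))// truncnS_gt.
have slack0 : {ae P, forall w, forall t, (t <= s)%N ->
    (fun k => slack Rp (m k w)%:R^-1 (x k w) (xi k) t w) @ \oo --> (0 : vect)}.
  apply: filterS3 (filterI axi xl) xil (ae_forall_leq hR1) => w [aw xw] xiw Rw t ts.
  have tT := leq_trans ts sT; have [R0 Rc] := Rw t tT.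
  by apply: slack_cvg0 ts tT Rc R0 aw _ (th_cvg w) xw xiw => k; rewrite invr_ge0.
(* The bound 2 is 1 for the normalised component, since on [B] the divisor exceeds the norm, plus
   eventually 1 for the slack. *)
have xi'_bd : {ae P, forall w, exists M, inf_many [set k | `|xi' k s w| <= M]}.
  apply: filterS2 thE slack0 => w E S; exists 2.
  have [j _ Sj] := (cvgrPdist_le _ _).1 (S s (leqnn s)) 1 ltr01.
  move=> i; exists (maxn i j); first exact: leq_maxl.
  have := Sj (maxn i j) (leq_maxr i j).
  rewrite /= E// /rescaled sub0r normrN; set k := maxn i j => Sk.
  rewrite (le_trans (ler_normB _ _))// -[leRHS]/(1 + 1) lerD//.
  rewrite normrZ ger0_norm ?invr_ge0// /m; case: asboolP => _; last by rewrite invr0 mul0r.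
  by rewrite mulrC ler_pdivrMr// mul1r ltW// truncnS_gt.
have [tau [mtau tau_ge tau_cvg]] := measurable_subsequence mxi'.
have mxt k : rvar (F s) (fun w => xi' (tau k w) s w).
  by apply: (@rvar_glue _ _ _ (F s) nat _ (tau k) (fun j w => xi' j s w)).
have [zs mzs zsl] := rvar_lim mxt.
have mth k : measurable_fun [set: T'] (fun w => (m k w)%:R^-1 : R).
  apply: (@measurable_fun_glue _ T' R nat (m k) (fun j _ => j%:R^-1)) => //.
have zs_cvg : {ae P, forall w, (fun k => xi' (tau k w) s w) @ \oo --> zs w}.
  apply: filterS xi'_bd => w /tau_cvg /cvg_ex[l cl]; have := cl.
  by move=> /zsl ->.
(* Initial positions, components before [s] and terminal values all tend to 0, while the component
   at [s] tends to [zs]; the induction hypothesis completes this to a strategy from 0 to 0. *)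
have [||||||zeta [z0 mz azeta]] := IH
    (fun k w => (m (tau k w) w)%:R^-1 *: x (tau k w) w)
    (fun k u w => xi' (tau k w) u w) (fun=> 0)
    (fun u w => if u == s then zs w else 0) (fun=> 0).
- move=> k sT'; apply: (rvar_filtration hF (leqnSn s) sT').
  apply: (@rvar_glue _ _ _ (F s) nat _ (tau k) (fun j w => (m j w)%:R^-1 *: x j w)) => //.
  by move=> j; exact: rvarZ.
- move=> k; apply: (adapted_fromS hF) => _ u uT.
  have sr : (s <= maxn s u)%N by rewrite leq_maxl.
  have rT : (maxn s u <= T)%N by rewrite geq_max sT.
  apply: (@rvar_glue _ _ _ _ nat _ (tau k) (fun j w => xi' j u w)).
    by move=> j; apply: (gmeas_mono (filtration_mono hF sr rT)).
  by move=> j; have [mj _ _ _] := xiP j; exact: mj.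
- have : {ae P, forall w, forall k,
      admissible T K (fun w => (m k w)%:R^-1 *: x k w) (xi' k) w}.
    by apply: ae_foralln => k; have [] := xiP k.
  by apply: filterS => w aw k; exact: (aw (tau k w)).
- apply: filterS xl => w xw; rewrite -(scale0r (xoo w)).
  apply: (@cvg_along _ (fun k => (m k w)%:R^-1 *: x k w) (tau^~ w)) => //.
  by apply: cvgZ => //; exact: th_cvg.
- apply: filterS3 (filterI thE slack0) zs_cvg xil => w [E S] zw xiw u.
  rewrite ltnS leq_eqVlt => /predU1P[->|us]; first by rewrite eqxx.
  rewrite ltn_eqF//.
  apply: (@cvg_along _ (fun k => xi' k u w) (tau^~ w)) => //.
  have uT : (u <= T)%N by rewrite (leq_trans (ltnW us)).
  under eq_fun do rewrite E//.
  rewrite -(subr0 0); apply: cvgB; last exact: S (ltnW us).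
  by rewrite -(scale0r (xioo u w)); apply: cvgZ; [exact: th_cvg|exact: xiw].
- have tE : {ae P, forall w, forall k, terminal T ((m k w)%:R^-1 *: x k w) Rp (xi' k) w =
       (m k w)%:R^-1 *: terminal T (x k w) Rp (xi k) w}.
    by apply: ae_foralln => k; have [] := xiP k.
  apply: filterS2 tE gl => w E gw.
  apply: (@cvg_along _ (fun k => terminal T ((m k w)%:R^-1 *: x k w) Rp (xi' k) w)
    (tau^~ w)) => //.
  under eq_fun do rewrite E.
  by rewrite -(scale0r (goo w)); apply: cvgZ => //; exact: th_cvg.
have zeta0 u : (u < s)%N -> zeta u = fun=> 0.
  by move=> us; rewrite z0 ?ltnS ?(ltnW us)// ltn_eqF.
have zetas : zeta s = zs by rewrite z0// eqxx.
(* Since the components before [s] vanish, [zeta] is adapted in the full sense, as [null_strategy]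
   requires. *)
have mzeta u : (u <= T)%N -> rvar (F u) (zeta u).
  move=> uT; case: (ltngtP u s) => [us|su|->]; last by rewrite zetas.
    by rewrite zeta0//; exact: rvar_cst.
  exact: mz.
have : {ae P, forall w, \sum_(t < T.+1) zeta t w = 0 /\ forall t, (t <= T)%N ->
    [/\ K t w (zeta t w), K t w (- zeta t w) & rsubmx (zeta t w) = 0]}.
  apply: (null_strategy hF hd hR hK hR1 hNA).
    split=> [t tT|t tT]; first by split; [exact: mzeta|exact: aeW].
    by apply: filterS azeta => w [/(_ t tT)].
  by apply: filterS azeta => w [].
move=> znull.
(* Solvency survives because [zeta] stays in the lineality spaces; claims and returns do not change,
   and the trades removed sum to 0. *)
pose xi'' k u w := xi k u w - (m k w)%:R *: zeta u w.
have comp k : competitor s (x k) (xi k) (xi'' k).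
  have mr r : (s <= r)%N -> (r <= T)%N ->
      measurable_fun [set: g_sigma_algebraType (F r)] (fun w => (m k w)%:R : R).
    move=> sr rT; apply: (gmfun_mono (filtration_mono hF sr rT)).
    by apply: (@measurable_fun_glue _ T' R nat (m k) (fun j _ => j%:R)).
  have clE : {ae P, forall w, forall t, (t <= T)%N -> claim (xi'' k) t w = claim (xi k) t w}.
    apply: filterS znull => w [_ zw] t tT; apply: eq_bigr => i _.
    have [|_ _ zF] := zw i; first by rewrite (leq_trans _ tT)// -ltnS.
    by rewrite /xi'' linearB linearZ /= zF scaler0 subr0.
  split.
  - move=> _ u uT; apply: rvarB; first exact: mxi.
    have sr : (s <= maxn s u)%N by rewrite leq_maxl.
    have rT : (maxn s u <= T)%N by rewrite geq_max sT.
    apply: rvarZ; first exact: mr.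
    by apply: (rvar_filtration hF (leq_maxr s u) rT); exact: mzeta.
  - apply: filterS3 (filterI clE axi) znull (cone_class_regular hK).
    move=> w [cE aw] [_ zw] Kw t tT; have [Kxi al0] := aw k t tT; rewrite cE//; split=> //.
    have [[_ KD KZ] _ _] := Kw t tT; have [Kz _ _] := zw t tT.
    by rewrite /xi'' opprB addrC; apply: KD => //; exact: KZ.
  - apply: filterS2 clE znull => w cE [zS _].
    rewrite /terminal /xi'' sumrB -scaler_sumr zS scaler0 subr0; congr (_ + _).
    by apply: eq_bigr => i _; rewrite -/(xi'' k) cE// ltnW.
  - by move=> r rs; apply/funext => w; rewrite /xi'' zeta0// scaler0 subr0.
have mD k : measurable [set w | `|xi'' k s w| + 1 <= `|xi k s w|].
  have mxs : rvar (F s) (xi'' k s).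
    by have [mk _ _ _] := comp k; have := mk sT s sT; rewrite maxnn.
  apply: (filtration_measurable hF sT); apply: (@mset_le _ T'); last exact: rvar_norm.
  by apply: measurable_funD; [exact: rvar_norm|exact: measurable_cst].
have := borel_cantelli_ae mD (fun k => xi_min k _ (comp k)).
apply: filterS3 (filterI zs_cvg slack0) thE => w [zw S] E [j Dj].
apply: contrapT => nM.
have Bw : B w.
  move=> M; apply: contrapT => nB; apply: nM; exists M%:R => i.
  apply: contrapT => ni; apply: nB; exists i => k ik; rewrite ltNge.
  by apply/negP => kM; apply: ni; exists k.
(* With an error 1/8 from the limit [zs], another 1/8 from the slack, and [m k] at most the norm
   plus 1, the new norm is at most a quarter of the old norm plus 1. A norm above 8 amply makes this
   a gain of 1. *)
have [i8 h8] := Bw 8%N.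
have e8 : 0 < 8^-1 :> R by rewrite invr_gt0.
have [iz _ hz] := (cvgrPdist_le _ _).1 zw _ e8.
have [iS _ hS] := (cvgrPdist_le _ _).1 (S s (leqnn s)) _ e8.
pose k0 := maxn (maxn j i8) (maxn iz iS).
(* Convergence to [zs] is read at [k0], the other three estimates at the selected index [k], which
   is at least [k0]. *)
pose k := tau k0 w.
have kk : (k0 <= k)%N by exact: tau_ge.
have jk : (j <= k)%N by rewrite (leq_trans _ kk)// /k0 !leq_max leqnn.
have i8k : (i8 <= k)%N by rewrite (leq_trans _ kk)// /k0 !leq_max leqnn orbT.
have iSk : (iS <= k)%N by rewrite (leq_trans _ kk)// /k0 !leq_max leqnn !orbT.
have izk : (iz <= k0)%N by rewrite /k0 !leq_max leqnn !orbT.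
apply: (Dj k jk) => /=; rewrite /xi'' zetas.
have mk : m k w = (Num.truncn `|xi k s w|).+1 by rewrite /m asboolT.
have mk0 : (m k w)%:R != 0 :> R by rewrite mk pnatr_eq0.
have -> : xi k s w - (m k w)%:R *: zs w = (m k w)%:R *:
   ((xi' k s w - zs w) + slack Rp (m k w)%:R^-1 (x k w) (xi k) s w).
  rewrite E// /rescaled addrAC subrK scalerBr scalerA mulfV// scale1r //.
have := hz k0 izk; rewrite /= -/k distrC => z8.
have := hS k iSk; rewrite /= sub0r normrN => s8.
have le4 : `|(xi' k s w - zs w) + slack Rp (m k w)%:R^-1 (x k w) (xi k) s w| <= 8^-1 + 8^-1.
  by rewrite (le_trans (ler_normD _ _))// lerD.
have k8 := h8 k i8k.
have mkle : (m k w)%:R <= `|xi k s w| + 1.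
  by rewrite mk -natr1 lerD2r; have /andP[] := truncn_itv (normr_ge0 (xi k s w)).
rewrite normrZ ger0_norm//.
have : (m k w)%:R * `|(xi' k s w - zs w) + slack Rp (m k w)%:R^-1 (x k w) (xi k) s w|
    <= (`|xi k s w| + 1) * (8^-1 + 8^-1) by rewrite ler_pM.
move=> h; have h4 : (8^-1 + 8^-1 : R) = 4^-1 by field.
rewrite h4 in h; move: h k8.
set a := `|xi k s w|; set b := _ * _; lra.
Qed.

Lemma closed_fromS s : (s <= T)%N -> closed_from s.+1 -> closed_from s.
Proof.
move=> sT IH x xi xoo xioo goo mx mxi axi xl xil gl.
have /choice[xs xsP] : forall k, exists xs, competitor s (x k) (xi k) xs /\
    forall xi', competitor s (x k) (xi k) xi' ->
      (P [set w | `|xi' s w| + 1 <= `|xs s w|]%R <= (1 / (2 ^ k.+1)%:R)%:E)%E.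
  move=> k; have [||xs] := @near_minimal_competitor s (x k) (xi k) (1 / (2 ^ k.+1)%:R) sT.
  - by rewrite div1r invr_gt0 ltr0n expn_gt0.
  - by split=> //; [apply: filterS axi => w|exact: aeW].
  - by move=> ? ?; exists xs.
have mxs k : adapted_from T F s (xs k) by have [[]] := xsP k.
have axs : {ae P, forall w, forall k, admissible T K (x k) (xs k) w}.
  by apply: ae_foralln => k; have [[]] := xsP k.
have xsE k u : (u < s)%N -> xs k u = xi k u by have [[_ _ _ e] _] := xsP k; exact: e.
have xsl : {ae P, forall w, forall u, (u < s)%N ->
    (fun k => xs k u w) @ \oo --> (xioo u w : vect)}.
  by apply: filterS xil => w xw u us; under eq_fun do rewrite xsE//; exact: xw.
have tE : {ae P, forall w, forall k,
    terminal T (x k w) Rp (xs k) w = terminal T (x k w) Rp (xi k) w}.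
  by apply: ae_foralln => k; have [[]] := xsP k.
have gsl : {ae P, forall w,
    (fun k => terminal T (x k w) Rp (xs k) w) @ \oo --> (goo w : vect)}.
  by apply: filterS2 tE gl => w E gw; under eq_fun do rewrite E.
have mx' k : rvar (F s) (x k) by exact: mx.
have xs_bd : {ae P, forall w, exists M, inf_many [set k | `|xs k s w| <= M]}.
  (* A competitor of [xs k] is one of [xi k], so near-minimality carries over. *)
  apply: (minimal_strategies_bounded sT IH mx' mxs axs xl xsl gsl) => k xi' [c1 c2 c3 c4].
  have [[_ _ tk _] +] := xsP k; apply; split=> //.
    by apply: filterS2 c3 tk => w -> ->.
  by move=> r rs; rewrite c4// xsE.
have mxss k : rvar (F s) (xs k s) by have := mxs k sT s sT; rewrite maxnn.
have [tau [mtau tau_ge tau_cvg]] := measurable_subsequence mxss.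
have mxt k : rvar (F s) (fun w => xs (tau k w) s w).
  by apply: (@rvar_glue _ _ _ (F s) nat _ (tau k) (fun j w => xs j s w)).
have [zs mzs zsl] := rvar_lim mxt.
(* [admissible] and [terminal] look at one path only, so they commute with a random index applied to
   strategies and initial positions alike. *)
have [||||||xi' [xi'0 mxi' axi']] := IH
    (fun k w => x (tau k w) w) (fun k u w => xs (tau k w) u w) xoo
    (fun u w => if u == s then zs w else xioo u w) goo.
- move=> k sT'; apply: (rvar_filtration hF (leqnSn s) sT').
  by apply: (@rvar_glue _ _ _ (F s) nat _ (tau k) (fun j w => x j w)).
- move=> k; apply: (adapted_fromS hF) => _ u uT.
  have sr : (s <= maxn s u)%N by rewrite leq_maxl.
  have rT : (maxn s u <= T)%N by rewrite geq_max sT.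
  apply: (@rvar_glue _ _ _ _ nat _ (tau k) (fun j w => xs j u w)).
    by move=> j; apply: (gmeas_mono (filtration_mono hF sr rT)).
  by move=> j; exact: mxs.
- by apply: filterS axs => w aw k; exact: (aw (tau k w)).
- apply: filterS xl => w xw.
  exact: (@cvg_along _ (fun k => x k w) (tau^~ w)).
- apply: filterS2 xs_bd xsl => w bw xw u; rewrite ltnS leq_eqVlt => /predU1P[->|us].
    by rewrite eqxx; have /cvg_ex[l cl] := tau_cvg w bw; have := cl; move=> /zsl ->.
  rewrite ltn_eqF//; apply: (@cvg_along _ (fun k => xs k u w) (tau^~ w)) => //.
  exact: xw.
- apply: filterS gsl => w gw.
  exact: (@cvg_along _ (fun k => terminal T (x k w) Rp (xs k) w) (tau^~ w)).
exists xi'; split=> //.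
  by move=> u us; rewrite xi'0 ?ltnS ?(ltnW us)//; apply/funext => w; rewrite ltn_eqF.
move=> u; rewrite leq_eqVlt => /predU1P[<-|su] uT; last exact: mxi'.
by rewrite xi'0// eqxx.
Qed.

Lemma closed_from0 : closed_from 0.
Proof.
have : forall j, (j <= T.+1)%N -> closed_from (T.+1 - j).
  elim=> [_|j IH jT]; first by rewrite subn0; exact: closed_from_horizon.
  apply: closed_fromS; first by rewrite subSS leq_subr.
  by rewrite subSS -subSn//; apply: IH; exact: ltnW.
by move=> /(_ T.+1 (leqnn _)); rewrite subnn.
Qed.

Lemma attainable_closed (x : vect) (f : nat -> Omega -> vect) g :
  (forall k, attainable P T F x K Rp (f k)) -> L0 P (fun=> setT) (F T) g ->
  {ae P, forall w, f k w @[k --> \oo] --> (g w : vect)} -> attainable P T F x K Rp g.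
Proof.
move=> Sf mg fg; split=> //.
have /choice[xi xiP] : forall k, exists xi, strategies P T F x K xi /\
    {ae P, forall w, f k w = terminal T x Rp xi w}.
  by move=> k; have [_ [xi ? ?]] := Sf k; exists xi.
have [||||||xi' [_ mxi' axi']] := @closed_from0
    (fun _ _ => x) xi (fun=> x) (fun _ _ => 0) g.
- by move=> k _; exact: rvar_cst.
- by move=> k _ u uT; rewrite max0n; have [[mk _] _] := xiP k; have [] := mk u uT.
- apply: ae_foralln => k; apply: ae_forall_leq => t tT.
  by have [[_ ak] _] := xiP k; exact: ak.
- by apply: aeW => w; exact: cvg_cst.
- exact: aeW.
- have fE : {ae P, forall w, forall k, f k w = terminal T x Rp (xi k) w}.
    by apply: ae_foralln => k; have [] := xiP k.
  by apply: filterS2 fE fg => w E fw; under eq_fun do rewrite -E.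
exists xi'; last by apply: filterS axi' => w [].
split=> t tT; first by split; [exact: mxi'|exact: aeW].
by apply: filterS axi' => w [/(_ t tT)].
Qed.

End closing.

Theorem theorem3p1 (disp : measure_display) (Omega : measurableType disp)
    (R : realType) (P : probability Omega R) (T d N : nat)
    (hT : (1 <= T)%N) (hd : (1 <= d)%N) (hN : (1 <= N)%N)
    (F : nat -> set (set Omega)) (hF : filtered_space P T F)
    (K : cone_process Omega R d N) (Rp : production_process Omega R d N)
    (hK : cone_class P T F K) (hR : production_class T F Rp)
    (hR1 : R1 P T Rp) (hR2 : R2 P T F K Rp) (hR3 : R3 P T F Rp)
    (hNA : NAr P T F K Rp)
    (x : 'rV[R]_(d + N)) (hx : nneg (rsubmx x)) :
  closed_in_probability P T F (attainable P T F x K Rp) /\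
  proc_closed_in_probability P T F (consumption P T F x K Rp).
Proof.
have mdist n t (f g : Omega -> 'rV[R]_n) : (t <= T)%N -> rvar (F t) f -> rvar (F t) g ->
    measurable_fun [set: Omega] (fun w => `|f w - g w|).
  move=> tT mf mg; apply: (filtration_measurable_fun hF tT).
  by apply: rvar_norm; exact: rvarB.
split=> [f g Sf mg fg|f g Sf mg fg].
  have [_ k|_|phi _ fphi] := @cvg_prob_subsequence _ _ _ P unit _ (fun=> f) (fun=> g).
  - by have [[mf _] _] := Sf k; apply: (mdist _ T) => //; case: mg.
  - exact: fg.
  apply: (attainable_closed hF hd hK hR hR1 hR2 hNA (f := fun k => f (phi k))) => //.
  exact: fphi tt.
(* All dates share the subsequence, so total consumption converges almost surely along it and
   closedness of the attainable set applies. *)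
have [i k|i|phi _ fphi] := @cvg_prob_subsequence _ _ _ P 'I_T.+1 _
    (fun i k => f k i) (fun i => g i).
- have iT : (i <= T)%N by rewrite -ltnS.
  by have [mf _] := Sf k; apply: (mdist _ i) => //; [case: (mf i iT)|case: (mg i iT)].
- by apply: fg; rewrite -ltnS.
split=> [t tT|].
  split; first by case: (mg t tT).
  have tT' : (t < T.+1)%N by rewrite ltnS.
  have f0 : {ae P, forall w, forall k, nneg (f (phi k) t w)}.
    by apply: ae_foralln => k; have [mf _] := Sf (phi k); case: (mf t tT).
  by apply: filterS2 f0 (fphi (Ordinal tT')) => w fw; exact: nneg_closed.
have sphi : {ae P, forall w, (fun k => \sum_(t < T.+1) f (phi k) t w) @ \oo -->
    (\sum_(t < T.+1) g t w : 'rV[R]_d)}.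
  have ft t : (t <= T)%N -> {ae P, forall w,
      (fun k => f (phi k) t w) @ \oo --> (g t w : 'rV[R]_d)}.
    by move=> tT; have tT' : (t < T.+1)%N by []; exact: fphi (Ordinal tT').
  apply: filterS (ae_forall_leq ft) => w fw; apply: cvg_seq_sum => i.
  by apply: fw; rewrite -ltnS.
apply: (attainable_closed hF hd hK hR hR1 hR2 hNA
  (f := fun k w => row_mx (\sum_(t < T.+1) f (phi k) t w) 0)).
- by move=> k; have [_] := Sf (phi k).
- split; last exact: aeW.
  apply: rvar_row_mx0; apply: rvar_sum => i.
  have iT : (i <= T)%N by rewrite -ltnS.
  by case: (mg i iT) => mgi _; exact: (rvar_filtration hF iT (leqnn T)).
- apply: filterS sphi => w sw; apply: cvg_row => j.
  case: (fintype.split_ordP j) => i ->.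
    rewrite row_mxEl; under eq_fun do rewrite row_mxEl.
    exact: cvg_coord.
  rewrite row_mxEr; under eq_fun do rewrite row_mxEr.
  exact: cvg_cst.
Qed.
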